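(* Let $\mathcal{E}$ be an ellipse with semi-axes $a,b$ and center $O$, let $\mathcal{E}'$ be a circle of radius $r$ with the same center $O$, with $a>b>r>0$, and suppose that the pair admits a Poncelet 3-periodic family $\mathcal{F}$, i.e. a one-parameter family of triangles inscribed in $\mathcal{E}$ and circumscribed about $\mathcal{E}'$. For a triangle $P_1P_2P_3$ of $\mathcal{F}$, let $P_1',P_2',P_3'$ be the vertices of its anticevian triangle with respect to $O$ (which is its excentral triangle), let $\Delta_i$ be the area of the circumellipse of $P_1P_2P_3$ centered at $P_i'$, let $\Sigma_o=\Delta_1+\Delta_2+\Delta_3$, let $\Delta_o=\pi ab$ be the area of $\mathcal{E}$, and let $\rho=r/R$ be the ratio of the inradius to the circumradius of $P_1P_2P_3$. Then over $\mathcal{F}$, $\Sigma_o$ is invariant (the same for all triangles of $\mathcal{F}$) and is given by $$\Sigma_o=\left(1+\frac{4}{\rho}\right)\Delta_o .$$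
   Context: A Poncelet 3-periodic family of $(\mathcal{E},\mathcal{E}')$: every point of $\mathcal{E}$ is a vertex of a triangle whose three vertices lie on $\mathcal{E}$ and whose three sides are tangent to $\mathcal{E}'$; the family is the set of all such triangles. For an ellipse with semi-axes $a,b$ and a concentric circle of radius $r$ as here, such a family exists exactly when $r=\frac{ab}{a+b}$. The circle $\mathcal{E}'$ is the incircle of every triangle of $\mathcal{F}$, and $O$ is its incenter. It is known that the circumradius of every triangle of $\mathcal{F}$ is $R=\frac{ab}{2r}=\frac{a+b}{2}$, so $\rho=\frac{2r^2}{ab}$ is constant over $\mathcal{F}$. Trilinear coordinates $[u:v:w]$ of a point with respect to a triangle $P_1P_2P_3$ are its signed distances, up to a common factor, to the side lines opposite $P_1,P_2,P_3$ respectively (positive on the side of the line containing the triangle). The anticevian triangle of $P_1P_2P_3$ with respect to a point with trilinears $[u:v:w]$ has vertices $P_1'=[-u:v:w]$, $P_2'=[u:-v:w]$, $P_3'=[u:v:-w]$. With respect to the incenter $[1:1:1]$ these are the three excenters. A circumellipse of a triangle is an ellipse passing through its three vertices; the circumellipse centered at a given point is the one having that point as its center. *)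

(* Defs.v *)
From HB Require Import structures.
From mathcomp Require Import all_boot all_order all_algebra.
From mathcomp Require Import all_classical all_reals all_analysis.

Set Implicit Arguments.
Unset Strict Implicit.
Unset Printing Implicit Defensive.

Import Order.TTheory GRing.Theory Num.Theory.

Local Open Scope classical_set_scope.
Local Open Scope ring_scope.

Section plane.
Context {R : realType}.

(* Points and vectors of the Euclidean plane. The canonical norm of [R * R] is
   the sup norm, hence the explicit [dot] and [edist]. *)
Local Notation point2 := (R * R)%type.

Implicit Types (X Y Q : point2) (S C E : set point2).

Definition dot X Y : R := X.1 * Y.1 + X.2 * Y.2.

Definition perp X : point2 := (- X.2, X.1).

Definition edist X Y : R := Num.sqrt (dot (X - Y) (X - Y)).

Definition circle Q (s : R) : set point2 := [set X | edist Q X = s].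

(* [u] and [perp u] are the directions of the axes. *)
Definition is_ellipse Q (p q : R) C :=
  [/\ 0 < p, 0 < q & exists2 u : point2, dot u u = 1 &
    C = [set X | (dot (X - Q) u / p) ^+ 2
               + (dot (X - Q) (perp u) / q) ^+ 2 = 1]].

(* The union of the chords of a closed convex curve is the closed region that
   the curve bounds. *)
Definition enclosed C : set point2 :=
  [set X | exists Y Z (t : R), [/\ C Y, C Z, 0 <= t <= 1 &
    X = (Y.1 + t * (Z.1 - Y.1), Y.2 + t * (Z.2 - Y.2))]].

Definition area C : \bar R :=
  ((@lebesgue_measure R) \x (@lebesgue_measure R))%E (enclosed C).

Definition line X Y : set point2 :=
  [set (X.1 + t * (Y.1 - X.1), X.2 + t * (Y.2 - X.2)) | t in [set: R]].

(* A line is tangent to a circle iff they have exactly one common point;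
   [tangent] is only meant for this case. *)
Definition tangent (L C : set point2) := exists! X : point2, L X /\ C X.

(* Twice the signed area of [XYZ]. *)
Definition det3 X Y Z : R := dot (Z - X) (perp (Y - X)).

Implicit Types (P : 'I_3 -> point2) (i : 'I_3).

Definition is_triangle P := det3 (P 0) (P 1) (P 2%:R) != 0.

Definition opp1 P i : point2 := P (ordS i).
Definition opp2 P i : point2 := P (ordS (ordS i)).

Definition side_line P i : set point2 := line (opp1 P i) (opp2 P i).

(* Signed distance of [X] to the side line opposite to [P i], positive on the
   side of [P i]. *)
Definition sdist P i X : R :=
  Num.sg (det3 (opp1 P i) (opp2 P i) (P i)) *
  (det3 (opp1 P i) (opp2 P i) X / edist (opp1 P i) (opp2 P i)).

Definition has_trilinears P X (t : 'I_3 -> R) :=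
  exists2 k : R, k != 0 & forall i, sdist P i X = k * t i.

(* The default value [0] is only used when no such point exists; if [P] is a
   triangle, there is at most one. Likewise for the radii below. *)
Definition trilinear_point P (t : 'I_3 -> R) : point2 :=
  xget 0 [set X : point2 | has_trilinears P X t].

Definition anticevian P Q : 'I_3 -> point2 := fun i =>
  trilinear_point P (fun j => if j == i then - sdist P j Q else sdist P j Q).

Definition is_circumcircle P Q (s : R) := forall i, circle Q s (P i).

Definition circumradius P : R :=
  xget 0 [set s : R | exists Q, is_circumcircle P Q s].

Definition is_incircle P Q (s : R) :=
  (forall i, 0 < sdist P i Q) /\
  (forall i, tangent (side_line P i) (circle Q s)).

Definition inradius P : R := xget 0 [set s : R | exists Q, is_incircle P Q s].

Definition is_circumellipse P Q C :=
  (exists p q : R, is_ellipse Q p q C) /\ (forall i, C (P i)).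

Definition poncelet3_family (E E' : set point2) : set ('I_3 -> point2) :=
  [set P | [/\ is_triangle P, forall i, E (P i) &
               forall i, tangent (side_line P i) E']].

Definition admits_poncelet3_family (E E' : set point2) :=
  forall X, E X -> exists2 P, poncelet3_family E E' P & exists i, P i = X.

End plane.

(* Main.v *)
Require Import Defs.
From HB Require Import structures.
From mathcomp Require Import all_boot all_order all_algebra.
From mathcomp Require Import all_classical all_reals all_analysis.
From mathcomp Require Import ring lra.

Set Implicit Arguments.
Unset Strict Implicit.
Unset Printing Implicit Defensive.

Import Order.TTheory GRing.Theory Num.Theory.
Import numFieldNormedType.Exports.

Local Open Scope classical_set_scope.
Local Open Scope ring_scope.

(** In the coordinates that turn [E] into the unit circle, a chord is tangent to
    [E'] iff its endpoints are conjugate with respect to a fixed conic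
    [A x^2 + B y^2 = k]. A triangle with pairwise conjugate vertices forces a
    relation between [A], [B], [k] and the position of a vertex; applied at the
    ends of both axes it gives [r = ab/(a+b)]. The conjugacy then reads
    [q x x' + p y y' = - pq], with [p = b/(a+b)] and [q = a/(a+b)], and makes the
    barycentric coordinates [l_i] of [O] positive functions of the single vertices;
    hence [O] is the incenter.

    A circumellipse centered at a given point is unique and its area is a
    function of the barycentric coordinates of the center (Heron's formula in the
    areas of the triangles that it forms with the sides). At the [i]-th excenter
    this area is [pi ab / (1 - 2 l_i)]. The sum of the [1 / (1 - 2 l_i)] is constant
    on the family: the polar of one vertex meets the unit circle in the other two,
    so the sum is a rational function of a single vertex, and it simplifies to
    [1 + 2 / (pq)]. *)

(** * Triangles in the unit circle with pairwise conjugate vertices *)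

Section algebra.
Variable F : realFieldType.
Implicit Types (a b r p q t k : F).

(** The determinant [e] of the normal [(n1, n2)] and an endpoint satisfies Lagrange's identity
    [e^2 + k^2 = n] on the unit circle. Both endpoints thus share [e^2], and being distinct they
    have opposite [e]. *)
Lemma polar_chord (n1 n2 k x2 y2 x3 y3 : F) :
  let n := n1 ^+ 2 + n2 ^+ 2 in n != 0 ->
  x2 ^+ 2 + y2 ^+ 2 = 1 -> x3 ^+ 2 + y3 ^+ 2 = 1 -> (x2, y2) <> (x3, y3) ->
  n1 * x2 + n2 * y2 = k -> n1 * x3 + n2 * y3 = k ->
  exists e, [/\ e ^+ 2 = n - k ^+ 2,
    x2 = (k * n1 - e * n2) / n, y2 = (k * n2 + e * n1) / n,
    x3 = (k * n1 + e * n2) / n & y3 = (k * n2 - e * n1) / n].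
Proof.
move=> n nn u2 u3 d23 k2 k3.
pose e (x y : F) := y * n1 - x * n2.
have eE x y : x ^+ 2 + y ^+ 2 = 1 -> n1 * x + n2 * y = k -> e x y ^+ 2 = n - k ^+ 2.
  move=> u <-; have -> : n = n * (x ^+ 2 + y ^+ 2) by rewrite u mulr1.
  by rewrite /e /n; ring.
have xE x y : n1 * x + n2 * y = k -> x = (k * n1 - e x y * n2) / n.
  by move=> <-; apply: (canRL (mulfK nn)); rewrite /e /n; ring.
have yE x y : n1 * x + n2 * y = k -> y = (k * n2 + e x y * n1) / n.
  by move=> <-; apply: (canRL (mulfK nn)); rewrite /e /n; ring.
have e23 : e x3 y3 = - e x2 y2.
  have /eqP := eE _ _ u3 k3; rewrite -(eE _ _ u2 k2) eqf_sqr => /orP[] /eqP // h.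
  by case: d23; congr pair; [rewrite [LHS](xE _ _ k2) [RHS](xE _ _ k3) h|
    rewrite [LHS](yE _ _ k2) [RHS](yE _ _ k3) h].
exists (e x2 y2); split; first exact: eE.
- exact: xE.
- exact: yE.
- by rewrite [LHS](xE x3 y3) // e23; congr (_ / _); ring.
- by rewrite [LHS](yE x3 y3) // e23; congr (_ / _); ring.
Qed.

(* The three points are pairwise conjugate with respect to [A x^2 + B y^2 = k]. *)
Lemma conjugate_vertex (A B k x1 y1 x2 y2 x3 y3 : F) : 0 < A -> 0 < B ->
  x1 ^+ 2 + y1 ^+ 2 = 1 -> x2 ^+ 2 + y2 ^+ 2 = 1 -> x3 ^+ 2 + y3 ^+ 2 = 1 ->
  (x2, y2) <> (x3, y3) ->
  A * x1 * x2 + B * y1 * y2 = k -> A * x1 * x3 + B * y1 * y3 = k ->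
  A * x2 * x3 + B * y2 * y3 = k ->
  k ^+ 2 * (A + B) = A ^+ 2 * (B + k) * x1 ^+ 2 + B ^+ 2 * (A + k) * y1 ^+ 2.
Proof.
move=> A0 B0 u1 u2 u3 d23 k2 k3 k23.
have nn : (A * x1) ^+ 2 + (B * y1) ^+ 2 != 0.
  rewrite paddr_eq0 ?sqr_ge0 // !sqrf_eq0 !mulf_eq0 (gt_eqF A0) (gt_eqF B0) /=.
  by apply/negP => /andP[/eqP h1 /eqP h2]; move: u1; rewrite h1 h2; lra.
have [e [e2 x2E y2E x3E y3E]] := polar_chord nn u2 u3 d23 k2 k3.
move: k23; rewrite x2E y2E x3E y3E.
set n1 := A * x1; set n2 := B * y1; set n := n1 ^+ 2 + n2 ^+ 2 => k23.
(* Opposite values of [e] at the two endpoints leave only [e^2 = n - k^2], which eliminates the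
   second and third points. *)
have {}k23 : A * (k ^+ 2 * n1 ^+ 2 - e ^+ 2 * n2 ^+ 2)
    + B * (k ^+ 2 * n2 ^+ 2 - e ^+ 2 * n1 ^+ 2) = k * n ^+ 2.
  by rewrite -[in RHS]k23; field.
apply: (mulIf nn); rewrite -/n1 -/n2 -/n.
transitivity (k * n ^+ 2 + n * (A * n2 ^+ 2 + B * n1 ^+ 2)).
  by rewrite -k23 e2 /n /n1 /n2; ring.
by rewrite /n /n1 /n2; ring.
Qed.

(** The quadratic hypothesis puts the chord, scaled back by [a] and [b], at distance [r] from the
    center. On the unit circle its three squares are multiples of [w = 1 - x1 x2 - y1 y2], which is
    nonzero for distinct endpoints; cancelling [w] turns tangency into conjugacy. *)
Lemma chord_tangent a b r (x1 y1 x2 y2 : F) :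
  x1 ^+ 2 + y1 ^+ 2 = 1 -> x2 ^+ 2 + y2 ^+ 2 = 1 -> (x1, y1) <> (x2, y2) ->
  (a * b * (x1 * y2 - x2 * y1)) ^+ 2 =
    r ^+ 2 * ((a * (x1 - x2)) ^+ 2 + (b * (y1 - y2)) ^+ 2) ->
  ((a * b) ^+ 2 + r ^+ 2 * (a ^+ 2 - b ^+ 2)) * x1 * x2 +
  ((a * b) ^+ 2 - r ^+ 2 * (a ^+ 2 - b ^+ 2)) * y1 * y2 =
  r ^+ 2 * (a ^+ 2 + b ^+ 2) - (a * b) ^+ 2.
Proof.
move=> u1 u2 d12 h.
pose w := 1 - x1 * x2 - y1 * y2.
have wE : (x1 - x2) ^+ 2 + (y1 - y2) ^+ 2 = 2 * w by rewrite /w; lra.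
have w0 : w != 0.
  apply/eqP => w0; apply: d12; move: wE; rewrite w0 mulr0 => /eqP.
  rewrite paddr_eq0 ?sqr_ge0 // !sqrf_eq0 !subr_eq0.
  by move=> /andP[/eqP -> /eqP ->].
have e1 : (x1 * y2 - x2 * y1) ^+ 2 = w * (1 + x1 * x2 + y1 * y2).
  transitivity ((x1 ^+ 2 + y1 ^+ 2) * (x2 ^+ 2 + y2 ^+ 2) - (x1 * x2 + y1 * y2) ^+ 2).
    by ring.
  by rewrite u1 u2 /w; ring.
have s1 : y1 ^+ 2 = 1 - x1 ^+ 2 by lra.
have s2 : y2 ^+ 2 = 1 - x2 ^+ 2 by lra.
have e2 : (x1 - x2) ^+ 2 = w * (1 - x1 * x2 + y1 * y2).
  have -> : w * (1 - x1 * x2 + y1 * y2) = (1 - x1 * x2) ^+ 2 - y1 ^+ 2 * y2 ^+ 2.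
    by rewrite /w; ring.
  by rewrite s1 s2; ring.
have e3 : (y1 - y2) ^+ 2 = w * (1 + x1 * x2 - y1 * y2).
  have -> : (y1 - y2) ^+ 2 = 2 * w - (x1 - x2) ^+ 2 by lra.
  by rewrite e2; ring.
apply/eqP; rewrite -subr_eq0 -(mulrI_eq0 _ (mulfI w0)); apply/eqP.
move: h; rewrite !exprMn e1 e2 e3 => h.
transitivity ((a ^+ 2 * b ^+ 2) * (w * (1 + x1 * x2 + y1 * y2)) -
  r ^+ 2 * (a ^+ 2 * (w * (1 - x1 * x2 + y1 * y2)) +
  b ^+ 2 * (w * (1 + x1 * x2 - y1 * y2)))); first by ring.
by rewrite h subrr.
Qed.

(** The last two hypotheses are the relation of [conjugate_vertex] at [(1, 0)] and [(0, 1)]. Their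
    difference is [A - B] times [A B + k (A + B)]. *)
Lemma porism_radius a b r : 0 < r -> r < b -> b < a ->
  let A := (a * b) ^+ 2 + r ^+ 2 * (a ^+ 2 - b ^+ 2) in
  let B := (a * b) ^+ 2 - r ^+ 2 * (a ^+ 2 - b ^+ 2) in
  let k := r ^+ 2 * (a ^+ 2 + b ^+ 2) - (a * b) ^+ 2 in
  k ^+ 2 * (A + B) = A ^+ 2 * (B + k) -> k ^+ 2 * (A + B) = B ^+ 2 * (A + k) ->
  a * b = r * (a + b).
Proof.
move=> r0 rb ba A B k hA hB.
have AB : A - B != 0.
  rewrite (_ : A - B = 2 * (r ^+ 2 * ((a - b) * (a + b)))); last by rewrite /A /B; ring.
  by rewrite !mulf_neq0 ?expf_neq0 // gt_eqF //; lra.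
have h : A * B + k * (A + B) = 0.
  apply: (mulfI AB); rewrite mulr0.
  transitivity (A ^+ 2 * (B + k) - B ^+ 2 * (A + k)); first by ring.
  by rewrite -hA -hB subrr.
(* The left-hand side of [h] factors, up to sign, into four terms; the last three are positive
   because [r < b < a]. *)
have : (a * b - r * (a + b)) * ((a * b + r * (a + b)) *
    ((a * b - r * (a - b)) * (a * b + r * (a - b)))) = 0.
  by rewrite -oppr0 -h /A /B /k; ring.
have ab : 0 < a * b by rewrite mulr_gt0; lra.
have p1 : 0 < r * (a + b) by rewrite mulr_gt0; lra.
have p2 : 0 < r * (a - b) by rewrite mulr_gt0; lra.
have p3 : r * (a - b) < a * b.
  by rewrite mulrC ltr_pM // ?ltW //; lra.
move/eqP; rewrite mulf_eq0 subr_eq0 => /orP[/eqP //|].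
by rewrite !mulf_eq0 !gt_eqF //; lra.
Qed.

(** * The conjugacy [q x x' + p y y' = - p q] *)

Section conjugate.
Variables p q : F.
Hypotheses (p0 : 0 < p) (q0 : 0 < q) (pq1 : p + q = 1).
(* On the Poncelet family, [t = r^2/(ab)] is half of [rho]. *)
Let t := p * q.
(** Squared length of [(q c, p s)], the normal of the polar of [(c, s)]; it is the [n] of
    [polar_chord]. *)
Let y (c s : F) := q ^+ 2 * c ^+ 2 + p ^+ 2 * s ^+ 2.

Lemma conjugate_norm_gt0 c s : c ^+ 2 + s ^+ 2 = 1 -> 0 < y c s.
Proof.
move=> u; have c0 := sqr_ge0 c; have s0 := sqr_ge0 s.
have p2 : 0 < p ^+ 2 by rewrite exprn_gt0.
have q2 : 0 < q ^+ 2 by rewrite exprn_gt0.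
have [h|h] := ltP 0 (c ^+ 2).
  by have := mulr_gt0 q2 h; have := mulr_ge0 (ltW p2) s0; rewrite /y; lra.
have h' : 0 < s ^+ 2 by lra.
by have := mulr_gt0 p2 h'; have := mulr_ge0 (ltW q2) c0; rewrite /y; lra.
Qed.

Lemma conjugate_form c s : c ^+ 2 + s ^+ 2 = 1 ->
  q * c ^+ 2 + p * s ^+ 2 = y c s + t.
Proof.
move=> u; transitivity (q * (p + q) * c ^+ 2 + p * (p + q) * s ^+ 2).
  by rewrite pq1 !mulr1.
by rewrite /y -[t]mulr1 -u /t; ring.
Qed.

Section triangle.
Variables c1 s1 c2 s2 c3 s3 : F.
Hypotheses (u1 : c1 ^+ 2 + s1 ^+ 2 = 1) (u2 : c2 ^+ 2 + s2 ^+ 2 = 1)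
  (u3 : c3 ^+ 2 + s3 ^+ 2 = 1).
Hypotheses (e12 : q * c1 * c2 + p * s1 * s2 = - t)
  (e13 : q * c1 * c3 + p * s1 * s3 = - t).
Let d1 := c2 * s3 - c3 * s2.
Let d2 := c3 * s1 - c1 * s3.
Let d3 := c1 * s2 - c2 * s1.
Let D := d1 + d2 + d3.
Hypothesis D0 : D != 0.

(** The vector identity [d1 P1 + d2 P2 + d3 P3 = 0] is paired with [P1] through the conic form.
    Hence [d1 / D], a barycentric coordinate of the origin, depends on the first vertex alone. *)
Lemma conjugate_barycentric : d1 * (y c1 s1 + 2 * t) = t * D.
Proof.
have -> : y c1 s1 + 2 * t = q * c1 ^+ 2 + p * s1 ^+ 2 + t.
  by rewrite conjugate_form //; ring.
have : d1 * (q * c1 ^+ 2 + p * s1 ^+ 2) + d2 * (q * c1 * c2 + p * s1 * s2)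
   + d3 * (q * c1 * c3 + p * s1 * s3) = 0 by rewrite /d1 /d2 /d3; ring.
by rewrite e12 e13 /D => h; apply/eqP; rewrite -subr_eq0; apply/eqP; rewrite -h; ring.
Qed.

(** The polar of the first vertex meets the circle in the other two, so [polar_chord] expresses
    their symmetric functions through the first vertex. *)
Lemma conjugate_opposite :
  d1 ^+ 2 = 4 * t ^+ 2 * (y c1 s1 - t ^+ 2) / (y c1 s1) ^+ 2 /\
  y c2 s2 + y c3 s3 =
    4 * t ^+ 2 * ((1 - t) * y c1 s1 - t ^+ 2) / (y c1 s1) ^+ 2.
Proof.
have y0 := conjugate_norm_gt0 u1.
have yn : y c1 s1 != 0 by rewrite gt_eqF.
have yE : y c1 s1 = (q * c1) ^+ 2 + (p * s1) ^+ 2 by rewrite /y; ring.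
have nn : (q * c1) ^+ 2 + (p * s1) ^+ 2 != 0 by rewrite -yE.
have d23 : (c2, s2) <> (c3, s3).
  case=> h1 h2; move: D0; rewrite /D /d1 /d2 /d3 h1 h2 => /eqP; apply; ring.
have [e] := polar_chord nn u2 u3 d23 e12 e13; rewrite -yE => -[e2 c2E s2E c3E s3E].
have d1E : d1 = (2 * t * e) / y c1 s1.
  rewrite /d1 c2E s2E c3E s3E.
  transitivity (2 * t * e * ((q * c1) ^+ 2 + (p * s1) ^+ 2) / (y c1 s1) ^+ 2); first by field.
  by rewrite -yE; field.
split.
  rewrite d1E; transitivity (4 * t ^+ 2 * e ^+ 2 / (y c1 s1) ^+ 2); first by field.
  by rewrite e2 sqrrN.
(* This and [y4'] evaluate the form [y] at the normal [(q c1, p s1)] and at its quarter turn; in the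
   sum over both endpoints the terms odd in [e] cancel. *)
have y4 : q ^+ 2 * (q * c1) ^+ 2 + p ^+ 2 * (p * s1) ^+ 2 = (1 - 2 * t) * y c1 s1 - t ^+ 2.
  have -> : 1 - 2 * t = p ^+ 2 + q ^+ 2.
    by rewrite /t; have := congr1 (fun x => x ^+ 2) pq1; rewrite expr1n; lra.
  by rewrite -[X in _ - X]mulr1 -u1 /y /t; ring.
have y4' : q ^+ 2 * (p * s1) ^+ 2 + p ^+ 2 * (q * c1) ^+ 2 = t ^+ 2.
  by rewrite -[RHS]mulr1 -u1 /t; ring.
transitivity (2 * (t ^+ 2 * (q ^+ 2 * (q * c1) ^+ 2 + p ^+ 2 * (p * s1) ^+ 2) +
    e ^+ 2 * (q ^+ 2 * (p * s1) ^+ 2 + p ^+ 2 * (q * c1) ^+ 2)) / (y c1 s1) ^+ 2).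
  by rewrite c2E s2E c3E s3E; move: (y c1 s1) yn => n nn0; rewrite /y; field.
by rewrite y4 y4' e2; field.
Qed.
End triangle.

(** The barycentric coordinates of the origin add up to [1], which gives one relation between the
    [y_i]; the value of [y2 + y3] in terms of [y1] gives a second one. *)
Lemma conjugate_symmetric c1 s1 c2 s2 c3 s3 (y1 := y c1 s1) (y2 := y c2 s2) (y3 := y c3 s3)
   (D := c2 * s3 - c3 * s2 + (c3 * s1 - c1 * s3) + (c1 * s2 - c2 * s1)) :
  c1 ^+ 2 + s1 ^+ 2 = 1 -> c2 ^+ 2 + s2 ^+ 2 = 1 -> c3 ^+ 2 + s3 ^+ 2 = 1 ->
  q * c1 * c2 + p * s1 * s2 = - t -> q * c2 * c3 + p * s2 * s3 = - t ->
  q * c3 * c1 + p * s3 * s1 = - t -> D != 0 ->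
  [/\ y1 * y2 * y3 = 4 * t ^+ 4,
      y2 * y3 + y1 * y3 + y1 * y2 = 4 * t ^+ 2 * (1 - t) &
      t ^+ 2 * D ^+ 2 = (y1 + 2 * t) * (y2 + 2 * t) * (y3 + 2 * t)].
Proof.
move=> u1 u2 u3 e12 e23 e31 D0.
have e13 : q * c1 * c3 + p * s1 * s3 = - t by rewrite -e31; ring.
have e21 : q * c2 * c1 + p * s2 * s1 = - t by rewrite -e12; ring.
have e32 : q * c3 * c2 + p * s3 * s2 = - t by rewrite -e23; ring.
have t0 : 0 < t by rewrite mulr_gt0.
have tn : t != 0 by rewrite gt_eqF.
have y10 : 0 < y1 by exact: conjugate_norm_gt0.
have y20 : 0 < y2 by exact: conjugate_norm_gt0.
have y30 : 0 < y3 by exact: conjugate_norm_gt0.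
have n1 : y1 + 2 * t != 0 by rewrite gt_eqF // addr_gt0 // mulr_gt0.
have n2 : y2 + 2 * t != 0 by rewrite gt_eqF // addr_gt0 // mulr_gt0.
have n3 : y3 + 2 * t != 0 by rewrite gt_eqF // addr_gt0 // mulr_gt0.
have b1 := conjugate_barycentric u1 e12 e13.
have b2 := conjugate_barycentric u2 e23 e21.
have b3 := conjugate_barycentric u3 e31 e32.
have [h1 h2] := conjugate_opposite u1 u2 u3 e12 e13 D0.
have b1' : (c2 * s3 - c3 * s2) = t * D / (y1 + 2 * t).
  by rewrite -b1 mulfK.
have b2' : (c3 * s1 - c1 * s3) = t * D / (y2 + 2 * t).
  have -> : D = c3 * s1 - c1 * s3 + (c1 * s2 - c2 * s1) + (c2 * s3 - c3 * s2) by rewrite /D; ring.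
  by rewrite -b2 mulfK.
have b3' : (c1 * s2 - c2 * s1) = t * D / (y3 + 2 * t).
  have -> : D = c1 * s2 - c2 * s1 + (c2 * s3 - c3 * s2) + (c3 * s1 - c1 * s3) by rewrite /D; ring.
  by rewrite -b3 mulfK.
have DE : D = t * D / (y1 + 2 * t) + t * D / (y2 + 2 * t) + t * D / (y3 + 2 * t).
  by rewrite -b1' -b2' -b3'.
have sum1 : t / (y1 + 2 * t) + t / (y2 + 2 * t) + t / (y3 + 2 * t) = 1.
  by apply: (mulIf D0); rewrite mul1r [RHS]DE; field; rewrite n1 n2 n3.
(* This is [sum1] with its denominators cleared; the terms linear in the [y_i] cancel. *)
have gram : y1 * y2 * y3 + t * (y2 * y3 + y1 * y3 + y1 * y2) = 4 * t ^+ 3.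
  apply/eqP; rewrite -subr_eq0; apply/eqP.
  rewrite -[RHS](_ : (1 - (t / (y1 + 2 * t) + t / (y2 + 2 * t) + t / (y3 + 2 * t))) *
    ((y1 + 2 * t) * (y2 + 2 * t) * (y3 + 2 * t)) = 0); last by rewrite sum1 subrr mul0r.
  by field; rewrite n1 n2 n3.
have m1 : y1 + t != 0 by rewrite gt_eqF // addr_gt0.
have yn1 : y1 != 0 by rewrite gt_eqF.
have prod23 : y2 * y3 = 4 * t ^+ 4 / y1.
  apply: (mulIf m1).
  transitivity (4 * t ^+ 3 - t * y1 * (y2 + y3)); first by rewrite -gram; ring.
  by rewrite h2 -/y1; field.
split.
- by rewrite -mulrA prod23; field.
- transitivity (y2 * y3 + y1 * (y2 + y3)); first by ring.
  by rewrite prod23 h2 -/y1; field.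
have -> : t ^+ 2 * D ^+ 2 = (t * D) ^+ 2 by ring.
rewrite -b1 exprMn h1 -/y1 -mulrA.
transitivity ((y1 + 2 * t) * (y2 * y3 + 2 * t * (y2 + y3) + 4 * t ^+ 2)); last by ring.
by rewrite prod23 h2 -/y1; field.
Qed.
End conjugate.
End algebra.

(** * Cyclic indices in ['I_3] *)

Lemma ordS3 (i : 'I_3) : ordS (ordS (ordS i)) = i.
Proof. by apply: val_inj; case: i => -[|[|[|]]]. Qed.

Lemma ordS_neq3 (i : 'I_3) : (ordS i == i) = false /\ (ordS (ordS i) == i) = false.
Proof. by case: i => -[|[|[|]]]. Qed.

Lemma sum3_cyclic (V : nmodType) (i : 'I_3) (f : 'I_3 -> V) :
  \sum_(j < 3) f j = f i + f (ordS i) + f (ordS (ordS i)).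
Proof.
rewrite (bigD1 i) //= (bigD1 (ordS i)) /=; last by rewrite (ordS_neq3 i).1.
rewrite (big_pred1 (ordS (ordS i))) ?addrA // => j.
by case: i => -[|[|[|]]] // ?; case: j => -[|[|[|]]].
Qed.

Lemma all3_cyclic (A : 'I_3 -> Prop) (i : 'I_3) :
  A i -> A (ordS i) -> A (ordS (ordS i)) -> forall j, A j.
Proof.
move=> h0 h1 h2 j; have : [|| j == i, j == ordS i | j == ordS (ordS i)].
  by case: i {h0 h1 h2} => -[|[|[|]]] // ?; case: j => -[|[|[|]]].
by case/or3P => /eqP ->.
Qed.

Lemma prod3_cyclic (F : comPzRingType) (i : 'I_3) (f : 'I_3 -> F) :
  \prod_(j < 3) f j = f i * f (ordS i) * f (ordS (ordS i)).
Proof.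
rewrite (bigD1 i) //= (bigD1 (ordS i)) /=; last by rewrite (ordS_neq3 i).1.
rewrite (big_pred1 (ordS (ordS i))) ?mulrA // => j.
by case: i => -[|[|[|]]] // ?; case: j => -[|[|[|]]].
Qed.

(** * Plane geometry *)

Section plane_geometry.
Context {R : realType}.
Local Notation point2 := (R * R)%type.
(* [edist] alone denotes the extended distance of MathComp-Analysis. *)
Local Notation dist := Defs.edist.
Implicit Types (X Y Z Q u : point2) (P : 'I_3 -> point2).

(** * Ellipses as quadratic forms *)

Definition conic Q (A B C : R) : set point2 :=
  [set X | A * (X.1 - Q.1) ^+ 2 + 2 * B * (X.1 - Q.1) * (X.2 - Q.2)
         + C * (X.2 - Q.2) ^+ 2 = 1].

(** The matrix of the form is [u u^T / p^2 + v v^T / q^2] with [v = perp u], so its eigenvalues are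
    [p^-2] and [q^-2]. *)
Lemma ellipse_conic Q p q K : is_ellipse Q p q K ->
  exists A B C : R, [/\ 0 < C, A * C - B ^+ 2 = (p * q) ^- 2 & K = conic Q A B C].
Proof.
case=> p0 q0 [[u1 u2]]; rewrite /dot /perp /= => uu ->.
exists (u1 ^+ 2 / p ^+ 2 + u2 ^+ 2 / q ^+ 2),
  (u1 * u2 / p ^+ 2 - u1 * u2 / q ^+ 2),
  (u2 ^+ 2 / p ^+ 2 + u1 ^+ 2 / q ^+ 2).
have pn : p != 0 by rewrite gt_eqF.
have qn : q != 0 by rewrite gt_eqF.
split.
- have : 0 < u2 ^+ 2 + u1 ^+ 2 by rewrite addrC !expr2 uu.
  have u10 := sqr_ge0 u1; have u20 := sqr_ge0 u2.
  have p2 : 0 < p ^+ 2 by rewrite exprn_gt0.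
  have q2 : 0 < q ^+ 2 by rewrite exprn_gt0.
  have -> : u2 ^+ 2 / p ^+ 2 + u1 ^+ 2 / q ^+ 2 =
      (u2 ^+ 2 * q ^+ 2 + u1 ^+ 2 * p ^+ 2) / (p * q) ^+ 2.
    by field; rewrite pn qn.
  move=> h; rewrite divr_gt0 ?exprn_gt0 ?mulr_gt0 //.
  have [k|k] := ltP 0 (u2 ^+ 2).
    by have := mulr_gt0 k q2; have := mulr_ge0 u10 (ltW p2); lra.
  have k1 : 0 < u1 ^+ 2 by lra.
  by have := mulr_gt0 k1 p2; have := mulr_ge0 u20 (ltW q2); lra.
- have e : (p * q) ^- 2 = (u1 * u1 + u2 * u2) ^+ 2 / (p * q) ^+ 2.
    by rewrite uu expr1n div1r.
  by rewrite e; field; rewrite pn qn.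
- by rewrite /conic; apply/seteqP; split=> -[x y] /= h; rewrite -[RHS]h; field; rewrite pn qn.
Qed.

(** Diagonalization of a symmetric matrix: a unit eigenvector gives an axis, and the eigenvalues are
    the inverse squares of the semi-axes. *)
Lemma conic_ellipse Q A B C : 0 < A -> 0 < A * C - B ^+ 2 ->
  exists p q, is_ellipse Q p q (conic Q A B C).
Proof.
move=> A0 D0.
suff [u1 [u2 [l1 [l2 [uu [eA eB eC]]]]]] : exists u1 u2 l1 l2 : R,
    u1 ^+ 2 + u2 ^+ 2 = 1 /\ [/\ l1 * u1 ^+ 2 + l2 * u2 ^+ 2 = A,
     (l1 - l2) * (u1 * u2) = B & l1 * u2 ^+ 2 + l2 * u1 ^+ 2 = C].
  have eS : l1 + l2 = A + C by rewrite -eA -eC -[LHS]mulr1 -uu; ring.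
  have eD : l1 * l2 = A * C - B ^+ 2.
    by rewrite -eA -eC -eB -[LHS]mulr1 -[1](expr1n R 2) -uu; ring.
  have C0 : 0 < C.
    by have := sqr_ge0 B; rewrite -(pmulr_rgt0 _ A0) => ?; lra.
  have l0 : 0 < l1 * l2 by rewrite eD.
  have l10 : 0 < l1.
    case: (ltP 0 l1) => // h; have : l2 < 0.
      rewrite ltNge; apply/negP => h2; have := mulr_le0_ge0 h h2; lra.
    by move=> ?; lra.
  have l20 : 0 < l2 by rewrite -(pmulr_rgt0 _ l10).
  exists (Num.sqrt l1)^-1, (Num.sqrt l2)^-1.
  split; rewrite ?invr_gt0 ?sqrtr_gt0 //; exists (u1, u2).
    by rewrite /dot -uu /=; ring.
  rewrite /conic /dot /perp /= -eA -eB -eC.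
  by apply/seteqP; split=> -[x y] /= h; rewrite -[RHS]h !invrK !exprMn !sqr_sqrtr 1?ltW //; ring.
(* If [B = 0], the form is already diagonal. Otherwise [(B, l1 - A)] is a nonzero eigenvector for
   the root [l1] of the characteristic equation, with squared length [n]. *)
have [B0|B0] := eqVneq B 0.
  by exists 1, 0, A, C; rewrite B0; split; last split; ring.
pose d := Num.sqrt ((A - C) ^+ 2 + 4 * B ^+ 2).
have d2 : d ^+ 2 = (A - C) ^+ 2 + 4 * B ^+ 2.
  by rewrite sqr_sqrtr //; have := sqr_ge0 (A - C); have := sqr_ge0 B; lra.
pose l1 := (A + C + d) / 2; pose l2 := (A + C - d) / 2.
have e1 : l1 ^+ 2 - (A + C) * l1 + (A * C - B ^+ 2) = 0.
  have -> : B ^+ 2 = (d ^+ 2 - (A - C) ^+ 2) / 4 by rewrite d2; field.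
  by rewrite /l1; field.
pose n := B ^+ 2 + (l1 - A) ^+ 2.
have n0 : 0 < n by rewrite ltr_wpDr ?sqr_ge0 // exprn_even_gt0.
have sn : Num.sqrt n ^+ 2 = n by rewrite sqr_sqrtr // ltW.
have sn0 : Num.sqrt n != 0 by rewrite gt_eqF // sqrtr_gt0.
have nn : n != 0 by rewrite gt_eqF.
have l2E : l2 = A + C - l1 by rewrite /l1 /l2; field.
clearbody l1 l2.
exists (B / Num.sqrt n), ((l1 - A) / Num.sqrt n), l1, l2.
have B2 : B ^+ 2 = l1 ^+ 2 - (A + C) * l1 + A * C by rewrite -[LHS]addr0 -e1; ring.
split; [|split].
- by rewrite !expr_div_n sn -mulrDl divff.
- rewrite !expr_div_n sn !mulrA -mulrDl; apply: (canLR (mulfK nn)).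
  by rewrite l2E /n -!mulrA -!expr2 B2; ring.
- transitivity ((l1 - l2) * (B * (l1 - A)) / Num.sqrt n ^+ 2); first by field.
  rewrite sn; apply: (canLR (mulfK nn)).
  by rewrite l2E /n B2; ring.
- rewrite !expr_div_n sn !mulrA -mulrDl; apply: (canLR (mulfK nn)).
  by rewrite l2E /n -!mulrA -!expr2 B2; ring.
Qed.

(** * Area of an ellipse *)

(** The integrand is the length of a vertical section of an ellipse whose form has determinant [D].
    The substitution [x = x0 + w sin h], with [w] the half-width of the ellipse, reduces it to a
    multiple of [cos^2]. *)
Lemma integral_half_disc (x0 C D : R) : 0 < C -> 0 < D ->
  (\int[lebesgue_measure]_x (2 * Num.sqrt (C - D * (x - x0) ^+ 2) / C)%:E
   = (pi / Num.sqrt D)%:E)%E.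
Proof.
move=> C0 D0.
pose w := Num.sqrt (C / D).
have w0 : 0 < w by rewrite sqrtr_gt0 divr_gt0.
have w2 : w ^+ 2 = C / D by rewrite sqr_sqrtr // ltW // divr_gt0.
have Dn : D != 0 by rewrite gt_eqF.
have Cn : C != 0 by rewrite gt_eqF.
pose F (h : R) := x0 + w * sin h.
pose G (x : R) := 2 * Num.sqrt (C - D * (x - x0) ^+ 2) / C.
have cG : continuous G.
  move=> x; apply: cvgM; last exact: cvg_cst.
  apply: cvgM; first exact: cvg_cst.
  apply: (@continuous_comp _ _ _ (fun x => C - D * (x - x0) ^+ 2) Num.sqrt);
    last exact: sqrt_continuous.
  by apply: cvgB; [exact: cvg_cst|apply: cvgM; [exact: cvg_cst|
    apply: (@continuous_comp _ _ _ (fun x => x - x0) (fun x => x ^+ 2));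
      [apply: cvgB; [exact: cvg_id|exact: cvg_cst]|exact: exprn_continuous]]].
have dF (h : R) : is_derive h (1 : R) F (w * cos h).
  by apply: is_derive_eq; rewrite /= ?scaler0 ?add0r ?addr0 /GRing.scale /=; ring.
have cF : continuous F.
  by move=> h; apply/differentiable_continuous/derivable1_diffP; case: (dF h).
have F'E : derive1 F = (fun h => w * cos h).
  by apply/funext => h; rewrite derive1E; case: (dF h).
have cF' : continuous (derive1 F).
  by rewrite F'E => h; apply: cvgM; [exact: cvg_cst|exact: continuous_cos].
have pi2 : 0 < pi / 2 :> R by rewrite divr_gt0 // pi_gt0.
have le_pi : - (pi / 2) < pi / 2 :> R by lra.
have FN : F (- (pi / 2)) = x0 - w by rewrite /F sinN sin_pihalf mulrN1.
have FP : F (pi / 2) = x0 + w by rewrite /F sin_pihalf mulr1.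
(* Since [Num.sqrt] is [0] on negative numbers, the integrand vanishes outside this interval. *)
transitivity (\int[lebesgue_measure]_(x in `[F (- (pi / 2))%R, F (pi / 2)%R]) (G x)%:E)%E.
  rewrite [RHS]integral_mkcond; apply: eq_integral => x _.
  rewrite patchE; case: ifPn => // /negP xN.
  rewrite ler0_sqrtr ?mulr0 ?mul0r // subr_le0.
  have {}xN : w ^+ 2 < (x - x0) ^+ 2.
    rewrite -(real_normK (num_real (x - x0))) ltrXn2r // ?nnegrE ?(ltW w0) // ltNge ler_norml.
    apply/negP => /andP[h1 h2]; apply: xN; rewrite inE /= in_itv /= FN FP.
    by apply/andP; split; lra.
  by move: xN; rewrite w2 ltr_pdivrMr // => /ltW; rewrite mulrC.
rewrite integration_by_substitution_increasing; first last.
- exact: continuous_subspaceT.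
- split => [h _||]; first by case: (dF h).
  + exact: cvg_at_right_filter (cF _).
  + exact: cvg_at_left_filter (cF _).
- by apply: cvgP; apply: cvg_at_left_filter; exact: cF'.
- by apply: cvgP; apply: cvg_at_right_filter; exact: cF'.
- by move=> h _; exact: cF'.
- by move=> h k hI kI hk; rewrite /F ltrD2l ltr_pM2l // ltr_sin.
- exact: ltW.
pose H (h : R) := (Num.sqrt D)^-1 * (h + sin h * cos h).
have dH (h : R) : is_derive h (1 : R) H (2 / Num.sqrt D * cos h ^+ 2).
  apply: is_derive_eq; rewrite /= ?scaler0 ?add0r ?addr0 /GRing.scale /=.
  have s2 : sin h ^+ 2 = 1 - cos h ^+ 2 by rewrite -(cos2Dsin2 h); ring.
  by rewrite mulrN -!expr2 s2; ring.
have cH : continuous H.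
  by move=> h; apply/differentiable_continuous/derivable1_diffP; case: (dH h).
transitivity (\int[lebesgue_measure]_(x in `[(- (pi / 2))%R, (pi / 2)%R])
    (2 / Num.sqrt D * cos x ^+ 2)%:E)%E.
  apply: eq_integral => h; rewrite inE /= in_itv /= => hI; congr EFin.
  rewrite F'E /G /= /F fctE /=.
  have -> : C - D * (x0 + w * sin h - x0) ^+ 2 = C * cos h ^+ 2.
    rewrite (_ : x0 + w * sin h - x0 = w * sin h); last ring.
    by rewrite exprMn w2 -[X in X - _]mulr1 -(cos2Dsin2 h); field.
  rewrite sqrtrM ?(ltW C0) // sqrtr_sqr ger0_norm ?cos_ge0_pihalf //.
  have sD : Num.sqrt D != 0 by rewrite gt_eqF // sqrtr_gt0.
  have -> : w = Num.sqrt C / Num.sqrt D by rewrite /w sqrtrM ?(ltW C0) // sqrtrV ?(ltW D0).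
  have sC : Num.sqrt C != 0 by rewrite gt_eqF // sqrtr_gt0.
  have aux (k d c : R) : k != 0 -> d != 0 ->
      2 * (k * c) / k ^+ 2 * (k / d * c) = 2 / d * c ^+ 2.
    by move=> k0 d0; field; rewrite k0 d0.
  by rewrite -(aux (Num.sqrt C)) // sqr_sqrtr // ltW.
rewrite (@continuous_FTC2 _ _ H) //.
- rewrite /H cosN sinN cos_pihalf -EFinB; congr EFin.
  by rewrite !mulr0 !addr0; field; rewrite gt_eqF // sqrtr_gt0.
- apply: continuous_subspaceT => h; apply: cvgM; first exact: cvg_cst.
  by apply: (@continuous_comp _ _ _ cos (fun x => x ^+ 2));
    [exact: continuous_cos|exact: exprn_continuous].
- split => [h _||]; first by case: (dH h).
  + exact: cvg_at_right_filter (cH _).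
  + exact: cvg_at_left_filter (cH _).
- by move=> h _; rewrite derive1E; case: (dH h).
Qed.
(** Positive definiteness makes the region convex, so it contains every chord. Conversely, a point
    of the region lies on the vertical chord through it. *)
Lemma enclosed_conic Q (A B C : R) : 0 < C -> 0 < A * C - B ^+ 2 ->
  enclosed (conic Q A B C) =
  [set X | A * (X.1 - Q.1) ^+ 2 + 2 * B * (X.1 - Q.1) * (X.2 - Q.2)
         + C * (X.2 - Q.2) ^+ 2 <= 1].
Proof.
move=> C0 D0; have Cn : C != 0 by rewrite gt_eqF.
pose form (x y : R) := A * x ^+ 2 + 2 * B * x * y + C * y ^+ 2.
have form_ge0 x y : 0 <= form x y.
  rewrite -(pmulr_rge0 _ C0).
  have -> : C * form x y = (A * C - B ^+ 2) * x ^+ 2 + (B * x + C * y) ^+ 2.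
    by rewrite /form; ring.
  by rewrite addr_ge0 ?sqr_ge0 // mulr_ge0 ?sqr_ge0 // ltW.
apply/seteqP; split=> [X [Y [Z [t [eY eZ /andP[t0 t1] ->]]]]|[x y] /= le1].
  rewrite /= -subr_ge0.
  set y1 := Y.1 - Q.1; set y2 := Y.2 - Q.2; set z1 := Z.1 - Q.1; set z2 := Z.2 - Q.2.
  have fY : form y1 y2 = 1 := eY.
  have fZ : form z1 z2 = 1 := eZ.
  have -> : Y.1 + t * (Z.1 - Y.1) - Q.1 = (1 - t) * y1 + t * z1 by rewrite /y1 /z1; ring.
  have -> : Y.2 + t * (Z.2 - Y.2) - Q.2 = (1 - t) * y2 + t * z2 by rewrite /y2 /z2; ring.
  have := form_ge0 (y1 - z1) (y2 - z2).
  have -> : form (y1 - z1) (y2 - z2) = form y1 y2 + form z1 z2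
      - 2 * (A * y1 * z1 + B * (y1 * z2 + y2 * z1) + C * y2 * z2).
    by rewrite /form; ring.
  rewrite fY fZ => le.
  have -> : 1 - (A * ((1 - t) * y1 + t * z1) ^+ 2
      + 2 * B * ((1 - t) * y1 + t * z1) * ((1 - t) * y2 + t * z2)
      + C * ((1 - t) * y2 + t * z2) ^+ 2)
    = 1 - ((1 - t) ^+ 2 * form y1 y2 + t ^+ 2 * form z1 z2
      + 2 * t * (1 - t) * (A * y1 * z1 + B * (y1 * z2 + y2 * z1) + C * y2 * z2)).
    by rewrite /form; ring.
  rewrite fY fZ.
  have t10 : 0 <= t * (1 - t) by rewrite mulr_ge0 // subr_ge0.
  have le' : 0 <= 1 - (A * y1 * z1 + B * (y1 * z2 + y2 * z1) + C * y2 * z2) by lra.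
  by have := mulr_ge0 t10 le'; lra.
(* [e^2] is a quarter of the discriminant of the conic as a quadratic in the second coordinate: the
   vertical line meets it at heights [(e - B x1) / C] and [(- e - B x1) / C] above [Q.2]. *)
pose x1 := x - Q.1; pose y1 := y - Q.2; pose e := Num.sqrt (C - (A * C - B ^+ 2) * x1 ^+ 2).
have le_e : (B * x1 + C * y1) ^+ 2 <= C - (A * C - B ^+ 2) * x1 ^+ 2.
  rewrite -subr_ge0.
  have -> : C - (A * C - B ^+ 2) * x1 ^+ 2 - (B * x1 + C * y1) ^+ 2 = C * (1 - form x1 y1).
    by rewrite /form; ring.
  by rewrite mulr_ge0 ?(ltW C0) // subr_ge0.
have e2 : e ^+ 2 = C - (A * C - B ^+ 2) * x1 ^+ 2.
  by rewrite sqr_sqrtr // (le_trans _ le_e) // sqr_ge0.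
have e0 : 0 <= e := sqrtr_ge0 _.
have chord s : s ^+ 2 = 1 -> conic Q A B C (x, Q.2 + (s * e - B * x1) / C).
  move=> s2; rewrite /conic /= -/x1.
  have -> : A * x1 ^+ 2 + 2 * B * x1 * (Q.2 + (s * e - B * x1) / C - Q.2)
      + C * (Q.2 + (s * e - B * x1) / C - Q.2) ^+ 2 =
      (s ^+ 2 * e ^+ 2 + (A * C - B ^+ 2) * x1 ^+ 2) / C by field.
  by rewrite s2 e2; field.
have Be : `|B * x1 + C * y1| <= e.
  by rewrite -sqrtr_sqr ler_wsqrtr.
(* For [e = 0] the vertical line is tangent: the chord is one point, and the parameter [0] avoids
   the denominator [2 e]. *)
have [e00|en] := eqVneq e 0.
  exists (x, Q.2 + (1 * e - B * x1) / C), (x, Q.2 + (1 * e - B * x1) / C), 0.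
  split; [exact: chord (expr1n _ _)|exact: chord (expr1n _ _)|by rewrite lexx ler01|].
  move: Be; rewrite e00 normr_le0 => /eqP h; congr pair => /=; first by ring.
  have -> : y = Q.2 + (B * x1 + C * y1 - B * x1) / C by rewrite /y1; field.
  by rewrite h; ring.
exists (x, Q.2 + (-1 * e - B * x1) / C), (x, Q.2 + (1 * e - B * x1) / C),
  ((B * x1 + C * y1 + e) / (2 * e)); split.
- by apply: chord; rewrite sqrrN expr1n.
- exact: chord (expr1n _ _).
- have e1 : 0 < 2 * e by rewrite mulr_gt0 // lt_neqAle eq_sym en.
  move: Be; rewrite ler_norml => /andP[h1 h2].
  by rewrite divr_ge0 ?(ltW e1) ?ler_pdivrMr //=; lra.
- by congr pair => /=; rewrite /y1; field; rewrite ?Cn ?en.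
Qed.

(** The product measure integrates the lengths of vertical sections. Completing the square shows
    that the section at [x] is centered at [c] with half-length [Num.sqrt d / C]. *)
Lemma area_conic Q (A B C : R) : 0 < C -> 0 < A * C - B ^+ 2 ->
  area (conic Q A B C) = (pi / Num.sqrt (A * C - B ^+ 2))%:E.
Proof.
move=> C0 D0; have Cn : C != 0 by rewrite gt_eqF.
rewrite -(integral_half_disc Q.1 C0 D0) /area enclosed_conic //.
apply: eq_integral => x _ /=; rewrite xsectionE.
set d := C - (A * C - B ^+ 2) * (x - Q.1) ^+ 2; set c := Q.2 - B * (x - Q.1) / C.
rewrite (_ : _ @^-1` _ = [set y | C ^+ 2 * (y - c) ^+ 2 <= d]); last first.
  have E y : (A * (x - Q.1) ^+ 2 + 2 * B * (x - Q.1) * (y - Q.2)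
      + C * (y - Q.2) ^+ 2 <= 1) = (C ^+ 2 * (y - c) ^+ 2 <= d).
    rewrite -subr_ge0 -[RHS]subr_ge0 -(pmulr_rge0 _ C0).
    by congr (0 <= _); rewrite /d /c; field.
  by apply/seteqP; split=> y /=; rewrite E.
have [d0|d0] := leP 0 d.
  have e0 := sqrtr_ge0 d.
  rewrite (_ : [set _ | _] = `[c - Num.sqrt d / C, c + Num.sqrt d / C]%classic).
    rewrite lebesgue_measure_itv /= lte_fin; case: ltP => h.
      by rewrite -EFinB; congr EFin; field.
    congr EFin; have : Num.sqrt d / C <= 0 by lra.
    by rewrite pmulr_lle0 ?invr_gt0 // => h'; have -> : Num.sqrt d = 0; [lra|ring].
  have key y : (C ^+ 2 * (y - c) ^+ 2 <= d) = (`|y - c| <= Num.sqrt d / C).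
    rewrite ler_pdivlMr // (_ : _ * C = Num.sqrt (C ^+ 2 * (y - c) ^+ 2)) ?ler_sqrt //.
    by rewrite -exprMn sqrtr_sqr normrM (ger0_norm (ltW C0)) mulrC.
  by apply/seteqP; split=> y /=; rewrite key in_itv /= ler_norml => /andP[? ?];
    apply/andP; split; lra.
(* For [d < 0] the section is empty, in agreement with the value [0] of [Num.sqrt d]. *)
rewrite (_ : [set _ | _] = set0); first by rewrite measure0 ltr0_sqrtr // mulr0 mul0r.
apply/seteqP; split=> y //= h; have := sqr_ge0 (C * (y - c)); rewrite exprMn; lra.
Qed.

(** * Circumellipses with a given center *)

(** The differences of the coefficients solve a homogeneous linear system whose determinant is a
    nonzero multiple of [d1 d2 d3]. The multipliers in the proof are its cofactors up to
    constants. *)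
Lemma circumellipse_uniq Q X Y Z (p q p' q' : R) (K K' : set point2) :
  det3 Q Y Z != 0 -> det3 Q Z X != 0 -> det3 Q X Y != 0 ->
  is_ellipse Q p q K -> is_ellipse Q p' q' K' ->
  K X -> K Y -> K Z -> K' X -> K' Y -> K' Z -> K = K'.
Proof.
move=> d1 d2 d3 /ellipse_conic[A [B [C [_ _ ->]]]] /ellipse_conic[A' [B' [C' [_ _ ->]]]].
rewrite /conic /=; move: d1 d2 d3; rewrite /det3 /dot /perp /=.
move: (X.1 - Q.1) (X.2 - Q.2) (Y.1 - Q.1) (Y.2 - Q.2) (Z.1 - Q.1) (Z.2 - Q.2).
move=> x1 y1 x2 y2 x3 y3.
set d1 := (X in X != 0); set d2 := (X in _ -> X != 0 -> _); set d3 := (X in _ -> _ -> X != 0 -> _).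
move=> d10 d20 d30 eX eY eZ eX' eY' eZ'.
have dn : d1 * d2 * d3 != 0 by rewrite !mulf_neq0.
pose f x y := (A - A') * x ^+ 2 + 2 * (B - B') * x * y + (C - C') * y ^+ 2.
have f1 : f x1 y1 = 0 by rewrite /f; lra.
have f2 : f x2 y2 = 0 by rewrite /f; lra.
have f3 : f x3 y3 = 0 by rewrite /f; lra.
have eA : A = A'.
  apply/eqP; rewrite -subr_eq0 -(mulIr_eq0 _ (mulIf dn)); apply/eqP.
  rewrite -[RHS](_ : - (f x1 y1 * (y2 * y3 * d1) + f x2 y2 * (y3 * y1 * d2)
    + f x3 y3 * (y1 * y2 * d3)) = 0); last by rewrite f1 f2 f3; ring.
  by rewrite /f /d1 /d2 /d3; ring.
have eC : C = C'.
  apply/eqP; rewrite -subr_eq0 -(mulIr_eq0 _ (mulIf dn)); apply/eqP.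
  rewrite -[RHS](_ : - (f x1 y1 * (x2 * x3 * d1) + f x2 y2 * (x3 * x1 * d2)
    + f x3 y3 * (x1 * x2 * d3)) = 0); last by rewrite f1 f2 f3; ring.
  by rewrite /f /d1 /d2 /d3; ring.
have eB : B = B'.
  apply/eqP; rewrite -subr_eq0 -(mulIr_eq0 _ (mulIf dn)); apply/eqP.
  rewrite -[RHS](_ : (f x1 y1 * ((x2 * y3 + x3 * y2) * d1)
    + f x2 y2 * ((x3 * y1 + x1 * y3) * d2)
    + f x3 y3 * ((x1 * y2 + x2 * y1) * d3)) / 2 = 0); last by rewrite f1 f2 f3; ring.
  by rewrite /f /d1 /d2 /d3; field.
by rewrite eA eB eC.
Qed.

(** In the inner product whose unit circle is the conic, the vectors from [Q] to the points are unit
    vectors with [d1 X + d2 Y + d3 Z = 0]. They close up to a triangle with sides [|d_i|], and [H]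
    is sixteen times its squared area. *)
Lemma circumellipse_area Q X Y Z (d1 d2 d3 : R) :
  det3 Q Y Z = d1 -> det3 Q Z X = d2 -> det3 Q X Y = d3 ->
  d1 != 0 -> d2 != 0 -> d3 != 0 ->
  let H := (d1 + d2 + d3) * (- d1 + d2 + d3) * (d1 - d2 + d3) * (d1 + d2 - d3) in
  0 < H ->
  exists2 K, [/\ exists p q, is_ellipse Q p q K, K X, K Y & K Z] &
    area K = (2 * pi * `|d1 * d2 * d3| / Num.sqrt H)%:E.
Proof.
move=> e1 e2 e3 d10 d20 d30 H H0.
pose x1 := X.1 - Q.1; pose y1 := X.2 - Q.2; pose x2 := Y.1 - Q.1.
pose y2 := Y.2 - Q.2; pose x3 := Z.1 - Q.1; pose y3 := Z.2 - Q.2.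
have {}e1 : d1 = x2 * y3 - x3 * y2 by rewrite -e1 /det3 /dot /perp /= /x1 /x2 /x3 /y1 /y2 /y3; ring.
have {}e2 : d2 = x3 * y1 - x1 * y3 by rewrite -e2 /det3 /dot /perp /= /x1 /x2 /x3 /y1 /y2 /y3; ring.
have {}e3 : d3 = x1 * y2 - x2 * y1 by rewrite -e3 /det3 /dot /perp /= /x1 /x2 /x3 /y1 /y2 /y3; ring.
(* The inner product of the vectors to [X] and [Y], read off from the squared length of
   [d1 X + d2 Y = - d3 Z]. Then [A], [B], [C] are the coefficients of [m^2 + n^2 + 2 s m n], with
   [m], [n] the coordinates in the basis of these two vectors. *)
pose s := (d3 ^+ 2 - d1 ^+ 2 - d2 ^+ 2) / (2 * d1 * d2).
pose A := (y1 ^+ 2 + y2 ^+ 2 - 2 * s * y1 * y2) / d3 ^+ 2.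
pose C := (x1 ^+ 2 + x2 ^+ 2 - 2 * s * x1 * x2) / d3 ^+ 2.
pose B := (s * (x1 * y2 + x2 * y1) - x1 * y1 - x2 * y2) / d3 ^+ 2.
have s2 : 1 - s ^+ 2 = H / (2 * d1 * d2) ^+ 2.
  by rewrite /s /H; field; rewrite d10 d20.
have dE : A * C - B ^+ 2 = (1 - s ^+ 2) / d3 ^+ 2.
  transitivity ((1 - s ^+ 2) * (x1 * y2 - x2 * y1) ^+ 2 / d3 ^+ 4).
    by rewrite /A /B /C; field.
  by rewrite -e3; field.
have s20 : 0 < 1 - s ^+ 2.
  by rewrite s2 divr_gt0 // exprn_even_gt0 // !mulf_neq0 // pnatr_eq0.
have D0 : 0 < A * C - B ^+ 2 by rewrite dE divr_gt0 // exprn_even_gt0.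
have AC0 : 0 < A * C by have := sqr_ge0 B; lra.
have C0 : 0 < C.
  rewrite lt_neqAle; apply/andP; split.
    by apply: contraTneq AC0 => <-; rewrite mulr0 ltxx.
  rewrite divr_ge0 ?sqr_ge0 //.
  have -> : x1 ^+ 2 + x2 ^+ 2 - 2 * s * x1 * x2 = (x2 - s * x1) ^+ 2 + (1 - s ^+ 2) * x1 ^+ 2.
    by ring.
  by rewrite addr_ge0 ?sqr_ge0 // mulr_ge0 ?sqr_ge0 // ltW.
have A0 : 0 < A by rewrite -(pmulr_lgt0 _ C0).
have formE x y : A * x ^+ 2 + 2 * B * x * y + C * y ^+ 2 =
    ((x * y2 - x2 * y) ^+ 2 + (x1 * y - x * y1) ^+ 2
    + 2 * s * (x * y2 - x2 * y) * (x1 * y - x * y1)) / d3 ^+ 2.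
  by rewrite /A /B /C; field.
exists (conic Q A B C); first split.
- exact: conic_ellipse.
- rewrite /conic /= -/x1 -/y1 formE -e3 (_ : x1 * y1 - x1 * y1 = 0); last ring.
  by field.
- rewrite /conic /= -/x2 -/y2 formE -e3 (_ : x2 * y2 - x2 * y2 = 0); last ring.
  by field.
- rewrite /conic /= -/x3 -/y3 formE.
  have -> : x3 * y2 - x2 * y3 = - d1 by rewrite e1; ring.
  have -> : x1 * y3 - x3 * y1 = - d2 by rewrite e2; ring.
  by rewrite /s; field; rewrite d30 d20 d10.
rewrite area_conic //; congr EFin.
have -> : A * C - B ^+ 2 = H / (2 * (d1 * d2 * d3)) ^+ 2.
  by rewrite dE s2; field; rewrite d30 d20 d10.
rewrite sqrtrM ?(ltW H0) // sqrtrV ?sqr_ge0 // sqrtr_sqr normrM gtr0_norm //.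
by field; rewrite normr_eq0 !mulf_neq0 // gt_eqF // sqrtr_gt0.
Qed.

(** * Signed areas, tangent lines and circumcircles *)

Lemma det3_rot X Y Z : det3 Y Z X = det3 X Y Z.
Proof. by rewrite /det3 /dot /perp /=; ring. Qed.

Lemma det3_split Q X Y Z : det3 X Y Z = det3 Y Z Q + det3 Z X Q + det3 X Y Q.
Proof. by rewrite /det3 /dot /perp /=; ring. Qed.

Lemma det3_cyclic P i : det3 (P i) (opp1 P i) (opp2 P i) = det3 (P 0) (P 1) (P 2%:R).
Proof.
rewrite /opp1 /opp2; case: i => -[|[|[|//]]] i3.
- by congr (det3 (P _) (P _) (P _)); apply: val_inj.
- by rewrite -det3_rot -det3_rot; congr (det3 (P _) (P _) (P _)); apply: val_inj.
- by rewrite -det3_rot; congr (det3 (P _) (P _) (P _)); apply: val_inj.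
Qed.

Lemma dot_ge0 X : 0 <= dot X X.
Proof. by rewrite addr_ge0 // -expr2 sqr_ge0. Qed.

Lemma dot_eq0 X : dot X X = 0 -> X = 0.
Proof.
case: X => x y; rewrite /dot /= -!expr2 => /eqP.
by rewrite paddr_eq0 ?sqr_ge0 // !sqrf_eq0 => /andP[/eqP -> /eqP ->].
Qed.

Lemma sqr_dist X Y : dist X Y ^+ 2 = dot (X - Y) (X - Y).
Proof. by rewrite sqr_sqrtr // dot_ge0. Qed.

Lemma circleP Q s X : circle Q s X <-> 0 <= s /\ dot (Q - X) (Q - X) = s ^+ 2.
Proof.
rewrite /circle /=; split=> [<-|[s0 e]]; first by rewrite sqrtr_ge0 sqr_dist.
by rewrite /Defs.edist e sqrtr_sqr ger0_norm.
Qed.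

(** Reflection in the foot of the perpendicular from [Q] preserves both line and circle, so a unique
    common point must be that foot. If [Y = Z], both sides of the equation are [0]. *)
Lemma tangent_circle Y Z Q s : tangent (line Y Z) (circle Q s) ->
  0 <= s /\ det3 Y Z Q ^+ 2 = s ^+ 2 * dist Y Z ^+ 2.
Proof.
case=> X [[[t _ tX] /circleP[s0 cX]] uniX]; split=> //.
have [L0|L0] := eqVneq (dist Y Z ^+ 2) 0.
  have /subr0_eq -> : Y - Z = 0 by apply: dot_eq0; rewrite -sqr_dist.
  by rewrite /det3 /Defs.edist /dot /perp /= !subrr !(mul0r, mulr0, oppr0, addr0) sqrtr0; ring.
pose f (v : R) : point2 := (Y.1 + v * (Z.1 - Y.1), Y.2 + v * (Z.2 - Y.2)).
have LE : dist Y Z ^+ 2 = (Z.1 - Y.1) ^+ 2 + (Z.2 - Y.2) ^+ 2.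
  by rewrite sqr_dist /dot /=; ring.
move: L0; rewrite LE; set L := (X in X != 0) => L0.
pose h := dot (Q - Y) (Z - Y) / L.
have distE v : dot (Q - f v) (Q - f v) = (v - h) ^+ 2 * L + det3 Y Z Q ^+ 2 / L.
  apply: (mulIf L0); rewrite /h.
  transitivity (((v * L - dot (Q - Y) (Z - Y)) ^+ 2) + det3 Y Z Q ^+ 2); last by field.
  by rewrite /f /L /det3 /dot /perp /=; ring.
have Xf : X = f t by rewrite -tX.
have : X = f (2 * h - t).
  apply: uniX; split; first by exists (2 * h - t).
  by apply/circleP; split=> //; rewrite -cX Xf !distE; ring.
rewrite Xf => -[/addrI e1 /addrI e2].
have th : t = h.
  have : (2 * (t - h)) * L = 0.
    rewrite (_ : _ * L = (t * (Z.1 - Y.1) - (2 * h - t) * (Z.1 - Y.1)) * (Z.1 - Y.1)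
      + (t * (Z.2 - Y.2) - (2 * h - t) * (Z.2 - Y.2)) * (Z.2 - Y.2));
      last by rewrite /L; ring.
    by rewrite e1 e2; ring.
  by move/eqP; rewrite !mulf_eq0 (negPf L0) pnatr_eq0 orbF /= subr_eq0 => /eqP.
by move: cX; rewrite Xf distE th subrr expr0n /= mul0r add0r => <-; rewrite divfK.
Qed.

(** The product of the sides is four times the area times the circumradius; squaring removes the
    sign of [det3]. *)
Lemma circumradius_det3 X Y Z Q s : circle Q s X -> circle Q s Y -> circle Q s Z ->
  0 <= s /\ (2 * det3 X Y Z * s) ^+ 2 = (dist Y Z * dist Z X * dist X Y) ^+ 2.
Proof.
move=> /circleP[s0 eX] /circleP[_ eY] /circleP[_ eZ]; split=> //.
rewrite !exprMn !sqr_dist -eX.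
move: eX eY eZ; rewrite /det3 /dot /perp /=.
case: X Y Z Q => [x1 x2] [y1 y2] [z1 z2] [q1 q2] /= eX eY eZ.
pose v1 := q1 - x1; pose v2 := q2 - x2.
have hy : 2 * (v1 * (y1 - x1) + v2 * (y2 - x2)) = (y1 - x1) ^+ 2 + (y2 - x2) ^+ 2.
  by rewrite /v1 /v2; lra.
have hz : 2 * (v1 * (z1 - x1) + v2 * (z2 - x2)) = (z1 - x1) ^+ 2 + (z2 - x2) ^+ 2.
  by rewrite /v1 /v2; lra.
pose d := (y1 - x1) * (z2 - x2) - (y2 - x2) * (z1 - x1).
pose ny := (y1 - x1) ^+ 2 + (y2 - x2) ^+ 2; pose nz := (z1 - x1) ^+ 2 + (z2 - x2) ^+ 2.
have hv1 : 2 * d * v1 = ny * (z2 - x2) - nz * (y2 - x2).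
  by rewrite /ny /nz -hy -hz /d; ring.
have hv2 : 2 * d * v2 = nz * (y1 - x1) - ny * (z1 - x1).
  by rewrite /ny /nz -hy -hz /d; ring.
transitivity ((2 * d * v1) ^+ 2 + (2 * d * v2) ^+ 2).
  by rewrite /d /v1 /v2; ring.
by rewrite hv1 hv2 /ny /nz; ring.
Qed.

(** This keeps [circumradius] away from its default value. The center solves the equations of two
    perpendicular bisectors by Cramer's rule. *)
Lemma circumcircle_ex P : is_triangle P -> exists s Q, is_circumcircle P Q s.
Proof.
rewrite /is_triangle.
suff main (X Y Z : point2) : det3 X Y Z != 0 ->
    exists s Q, [/\ circle Q s X, circle Q s Y & circle Q s Z].
  move=> /main[s [Q [h0 h1 h2]]]; exists s, Q => -[[|[|[|//]]] i3].
  - by rewrite (_ : Ordinal i3 = 0) //; apply: val_inj.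
  - by rewrite (_ : Ordinal i3 = 1) //; apply: val_inj.
  - by rewrite (_ : Ordinal i3 = 2%:R) //; apply: val_inj.
rewrite /det3 /dot /perp /=; case: X Y Z => [x1 x2] [y1 y2] [z1 z2] /=.
set d := (X in X != 0) => d0.
pose ny := (y1 - x1) ^+ 2 + (y2 - x2) ^+ 2; pose nz := (z1 - x1) ^+ 2 + (z2 - x2) ^+ 2.
pose Q : point2 := (x1 + (ny * (z2 - x2) - nz * (y2 - x2)) / (2 * d),
                    x2 + (nz * (y1 - x1) - ny * (z1 - x1)) / (2 * d)).
have hy : 2 * ((Q.1 - x1) * (y1 - x1) + (Q.2 - x2) * (y2 - x2)) = ny.
  transitivity (ny * d / d); last by rewrite mulfK.
  by rewrite /Q /= {3}/d; field.
have hz : 2 * ((Q.1 - x1) * (z1 - x1) + (Q.2 - x2) * (z2 - x2)) = nz.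
  transitivity (nz * d / d); last by rewrite mulfK.
  by rewrite /Q /= {3}/d; field.
exists (dist Q (x1, x2)), Q; rewrite /circle /=; split=> //; rewrite /Defs.edist; congr Num.sqrt.
- move: hy; rewrite /ny /dot /=; lra.
- move: hz; rewrite /nz /dot /=; lra.
Qed.

(** * Triangles with given incenter *)

Section incenter.
Variables (P : 'I_3 -> point2) (O : point2) (r : R) (lam : 'I_3 -> R).
Let D := det3 (P 0) (P 1) (P 2%:R).
Hypotheses (P_triangle : is_triangle P) (r_gt0 : 0 < r) (lam_gt0 : forall i, 0 < lam i).
Hypothesis P_tangent : forall i, tangent (side_line P i) (circle O r).
Hypothesis O_bary : forall i, det3 (opp1 P i) (opp2 P i) O = lam i * D.

Let D0 : D != 0. Proof. exact: P_triangle. Qed.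
Let nD0 : 0 < `|D|. Proof. by rewrite normr_gt0. Qed.
Let lam0 i : lam i != 0. Proof. by rewrite gt_eqF. Qed.
Let r0 : r != 0. Proof. by rewrite gt_eqF. Qed.

Lemma sum_bary Q : \sum_i det3 (opp1 P i) (opp2 P i) Q = D.
Proof.
rewrite (sum3_cyclic 0) /opp1 /opp2 !ordS3 -[RHS](det3_cyclic P 0) /opp1 /opp2.
by rewrite [RHS](det3_split Q).
Qed.

Lemma sum_lam : \sum_i lam i = 1.
Proof.
apply: (mulIf D0); rewrite mul1r mulr_suml -[RHS](sum_bary O).
by apply: eq_bigr => i _; rewrite O_bary.
Qed.

(** Twice the area of the triangle with apex [O] over a side is [r] times the side, and also [lam i]
    times [|D|]. *)
Lemma side_length i : dist (opp1 P i) (opp2 P i) = lam i * `|D| / r.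
Proof.
have [_] := tangent_circle (P_tangent i); rewrite O_bary => e.
apply: (mulIf r0); rewrite divfK //.
apply/eqP; rewrite -(@eqrXn2 _ 2) // ?mulr_ge0 ?sqrtr_ge0 ?normr_ge0 ?ltW //.
by rewrite exprMn mulrC -e exprMn exprMn real_normK // num_real.
Qed.

Lemma sdistE i X : sdist P i X = r * det3 (opp1 P i) (opp2 P i) X / (lam i * D).
Proof.
rewrite /sdist side_length det3_rot det3_cyclic -/D.
have -> : Num.sg D = `|D| / D by rewrite normrEsg -mulrA mulfV // mulr1.
have nD : `|D| != 0 by rewrite gt_eqF.
by field; rewrite r0 nD lam0 D0.
Qed.

Lemma sdist_incenter i : sdist P i O = r.
Proof. by rewrite sdistE O_bary mulfK // mulf_neq0. Qed.

Lemma inradiusE : inradius P = r.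
Proof.
apply: xget_unique => [|s [Q [Q0 Qs]]].
  by exists O; split=> // i; rewrite sdist_incenter.
(* Positivity of [sdist] fixes the sign that [tangent_circle] leaves open, which excludes the
   excircles. *)
have sQ i : sdist P i Q = s.
  have [s0] := tangent_circle (Qs i); rewrite side_length => e.
  apply/eqP; rewrite -(@eqrXn2 _ 2) // ?(ltW (Q0 i)) //.
  rewrite sdistE; set d := det3 _ _ _ in e *.
  rewrite expr_div_n exprMn e expr_div_n !exprMn real_normK ?num_real //.
  by apply/eqP; field; rewrite r0 lam0 D0.
have : \sum_i lam i * D * s / r = D.
  rewrite -[RHS](sum_bary Q); apply: eq_bigr => i _.
  by rewrite -(sQ i) sdistE; field; rewrite r0 lam0 D0.
rewrite -!mulr_suml sum_lam mul1r -mulrA => h.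
have : s / r = 1 by apply: (mulfI D0); rewrite h mulr1.
by move=> /(canRL (divfK r0)); rewrite mul1r.
Qed.

Lemma circumradiusE : circumradius P = lam 0 * lam 1 * lam 2%:R * D ^+ 2 / (2 * r ^+ 3).
Proof.
have := xgetPex (0 : R) (circumcircle_ex P_triangle).
rewrite -/(circumradius P); move: (circumradius P) => s [Q Qs].
have [s0] := circumradius_det3 (Qs 0) (Qs 1) (Qs 2%:R); rewrite -/D.
have := (side_length 0, side_length 1, side_length 2%:R).
rewrite /opp1 /opp2.
have o0 : ordS (0 : 'I_3) = 1 by apply: val_inj.
have o1 : ordS (1 : 'I_3) = 2%:R by apply: val_inj.
have o2 : ordS (2%:R : 'I_3) = 0 by apply: val_inj.
rewrite !(o0, o1, o2) => -[[-> ->] ->].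
have -> : (2 * D * s) ^+ 2 = (2 * `|D| * s) ^+ 2.
  by rewrite !exprMn real_normK // num_real.
have lamD i : 0 <= lam i * `|D| / r by rewrite divr_ge0 ?(ltW r_gt0) // mulr_ge0 ?(ltW (lam_gt0 _)).
move=> /eqP; rewrite eqrXn2 //; last 2 first.
- by rewrite !mulr_ge0.
- by rewrite mulr_ge0 // mulr_ge0.
move=> /eqP h.
have nD : `|D| != 0 by rewrite gt_eqF.
apply: (mulfI (_ : 2 * `|D| != 0)); first by rewrite mulf_neq0 // pnatr_eq0.
by rewrite h -[D ^+ 2]real_normK ?num_real //; field.
Qed.

(** * Excenters and their circumellipses *)

(** Side lengths are proportional to [lam], so trilinears times [lam] are barycentric coordinates up
    to a factor. The point with barycentrics [m] shows that the default is not taken, and the sum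
    [1] fixes the factor. *)
Lemma trilinear_det3 (t : 'I_3 -> R) (m : 'I_3 -> R) (k : R) :
  k != 0 -> (forall j, r * m j = k * t j * lam j) -> \sum_j m j = 1 ->
  forall j, det3 (opp1 P j) (opp2 P j) (trilinear_point P t) = m j * D.
Proof.
move=> k0 mt m1.
have : has_trilinears P (trilinear_point P t) t.
  apply: (@xgetPex _ 0 [set X | has_trilinears P X t]).
  exists (\sum_j m j * (P j).1, \sum_j m j * (P j).2).
  exists k => // j.
  have -> : k * t j = r * m j / lam j by rewrite mt mulfK.
  rewrite sdistE -[X in _ / X = _]mulrC invfM mulrA; congr (_ / _).
  rewrite -mulrA; congr (_ * _); apply: (canLR (mulfK D0)).
  move: m1; rewrite /D !(sum3_cyclic j) -(det3_cyclic P j) /opp1 /opp2 => m1.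
  have -> : m j = 1 - m (ordS j) - m (ordS (ordS j)) by rewrite -m1; ring.
  by rewrite /det3 /dot /perp /=; ring.
case=> k' k'0 hk'.
have e j : det3 (opp1 P j) (opp2 P j) (trilinear_point P t) = k' / k * m j * D.
  have -> : m j = k * t j * lam j / r by rewrite -mt mulrC mulKf.
  have := hk' j; rewrite sdistE => /(canRL (divfK (mulf_neq0 (lam0 j) D0))) h.
  by apply: (mulfI r0); rewrite h; field; rewrite r0 k0.
have kk : k' / k = 1.
  apply: (mulIf D0); rewrite mul1r -[RHS](sum_bary (trilinear_point P t)).
  under eq_bigr do rewrite e.
  by rewrite -mulr_suml -mulr_sumr m1 mulr1.
by move=> j; rewrite e kk mul1r.
Qed.

(** All trilinears of [O] equal [r]. Changing the sign of one barycentric coordinate lowers the sum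
    from [1] to [1 - 2 * lam i], by which the result is normalized. *)
Lemma excenter_det3 i : 1 - 2 * lam i != 0 -> forall j,
  det3 (opp1 P j) (opp2 P j) (anticevian P O i) =
  (if j == i then - lam j else lam j) / (1 - 2 * lam i) * D.
Proof.
move=> mi; apply: (trilinear_det3 (k := (1 - 2 * lam i)^-1)).
- by rewrite invr_eq0.
- by move=> j; case: ifP => _; rewrite sdist_incenter; field.
- have [n1 n2] := ordS_neq3 i.
  rewrite (sum3_cyclic i) eqxx n1 n2 -!mulrDl; apply: (canLR (mulfK mi)).
  by have := sum_lam; rewrite (sum3_cyclic i); lra.
Qed.

(** The hypothesis on [kap] says that [pi * kap] is the area given by [circumellipse_area] for the
    center [O] itself. *)
Lemma excentral_circumellipse (kap : R) i : 0 < kap ->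
  (forall j, 0 < 1 - 2 * lam j) ->
  kap ^+ 2 * \prod_j (1 - 2 * lam j) = 4 * D ^+ 2 * (\prod_j lam j) ^+ 2 ->
  exists C, [/\ is_circumellipse P (anticevian P O i) C,
    area C = (pi * kap / (1 - 2 * lam i))%:E &
    forall C', is_circumellipse P (anticevian P O i) C' -> C' = C].
Proof.
move=> kap0 m0 hk.
have mn j : 1 - 2 * lam j != 0 by rewrite gt_eqF.
have ex := excenter_det3 (mn i).
set Q := anticevian P O i in ex *.
have [n1 n2] := ordS_neq3 i.
set mi := 1 - 2 * lam i in ex *.
have mi0 : 0 < mi by exact: m0.
have min : mi != 0 by rewrite gt_eqF.
pose d1 := - lam i / mi * D.
pose d2 := lam (ordS i) / mi * D.
pose d3 := lam (ordS (ordS i)) / mi * D.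
have e1 : det3 Q (opp1 P i) (opp2 P i) = d1.
  by rewrite -det3_rot ex eqxx.
have e2 : det3 Q (opp2 P i) (P i) = d2.
  by rewrite -det3_rot; have := ex (ordS i); rewrite /opp1 /opp2 ordS3 n1.
have e3 : det3 Q (P i) (opp1 P i) = d3.
  by rewrite -det3_rot; have := ex (ordS (ordS i)); rewrite /opp1 /opp2 !ordS3 n2.
have d10 : d1 != 0 by rewrite /d1 !mulf_neq0 ?oppr_eq0 ?invr_eq0.
have d20 : d2 != 0 by rewrite /d2 !mulf_neq0 ?invr_eq0.
have d30 : d3 != 0 by rewrite /d3 !mulf_neq0 ?invr_eq0.
pose l := \prod_j lam j.
have lE : l = lam i * lam (ordS i) * lam (ordS (ordS i)) by exact: prod3_cyclic.
(* The Heron product is even in each [d_i], so apart from the scaling by [mi] it is the one for the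
   center [O]. *)
have HE : (d1 + d2 + d3) * (- d1 + d2 + d3) * (d1 - d2 + d3) * (d1 + d2 - d3) =
   (2 * `|D| ^+ 3 * l / (kap * mi ^+ 2)) ^+ 2.
  have kn : kap != 0 by rewrite gt_eqF.
  transitivity (D ^+ 4 * (kap ^+ 2 * \prod_j (1 - 2 * lam j)) / (kap * mi ^+ 2) ^+ 2).
    have := sum_lam; rewrite (sum3_cyclic i) (prod3_cyclic i) -/mi.
    move=> /(canRL (addrK _)) /(canRL (addrK _)) lamE.
    have mE : mi = 2 * lam (ordS i) + 2 * lam (ordS (ordS i)) - 1.
      by rewrite /mi lamE; ring.
    have := mn i; rewrite -/mi /d1 /d2 /d3 lamE mE => m'.
    by field; rewrite kn m'.
  have D6 : (`|D| ^+ 3) ^+ 2 = D ^+ 6 by rewrite exprAC real_normK ?num_real // -exprM.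
  rewrite hk -/l expr_div_n; congr (_ / _).
  by transitivity (4 * (`|D| ^+ 3) ^+ 2 * l ^+ 2); [rewrite D6; ring|ring].
have l0 : 0 < l by rewrite prodr_gt0.
have H0 : 0 < 2 * `|D| ^+ 3 * l / (kap * mi ^+ 2).
  by rewrite divr_gt0 ?mulr_gt0 ?exprn_gt0.
have := circumellipse_area e1 e2 e3 d10 d20 d30; rewrite HE => /(_ (exprn_gt0 _ H0)).
case=> C [[p [q Cpq]] C1 C2 C3] aC; exists C; split.
- by split; [exists p, q|exact: (@all3_cyclic (fun j => C (P j)) i)].
- rewrite aC sqrtr_sqr (gtr0_norm H0); congr EFin.
  have -> : d1 * d2 * d3 = - (l * D ^+ 3 / mi ^+ 3).
    by rewrite /d1 /d2 /d3 lE; field.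
  rewrite normrN normrM normrM normfV !normrX (gtr0_norm l0) (gtr0_norm mi0).
  by field; rewrite min !gt_eqF.
- move=> C' [[p' [q' Cpq']] C'P].
  by apply: (circumellipse_uniq _ _ _ Cpq' Cpq _ _ _ C1 C2 C3); rewrite ?e1 ?e2 ?e3 //; exact: C'P.
Qed.
End incenter.
End plane_geometry.

(** * The Poncelet family *)

Section porism.
Context {R : realType}.
Local Notation point2 := (R * R)%type.
Local Notation dist := Defs.edist.
Variables (O u : point2) (a b r : R).
Hypotheses (uu : dot u u = 1) (r_gt0 : 0 < r) (lt_rb : r < b) (lt_ba : b < a).
Let x (X : point2) := dot (X - O) u / a.
Let y (X : point2) := dot (X - O) (perp u) / b.
Let E : set point2 := [set X | x X ^+ 2 + y X ^+ 2 = 1].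
Implicit Types (X Y Z Q : point2) (P : 'I_3 -> point2).

Let b0 : 0 < b. Proof. exact: lt_trans lt_rb. Qed.
Let a0 : 0 < a. Proof. exact: lt_trans lt_ba. Qed.
Let an : a != 0. Proof. by rewrite gt_eqF. Qed.
Let bn : b != 0. Proof. by rewrite gt_eqF. Qed.

Lemma det3_coord Y Z : det3 O Y Z = a * b * (x Y * y Z - x Z * y Y).
Proof.
(* The identity holds only modulo [dot u u = 1]; the factor makes it a formal one. *)
transitivity (dot u u * det3 O Y Z); first by rewrite uu mul1r.
by rewrite /x /y /det3 /dot /perp /=; field; rewrite an bn.
Qed.

Lemma dist_coord Y Z :
  dist Y Z ^+ 2 = (a * (x Y - x Z)) ^+ 2 + (b * (y Y - y Z)) ^+ 2.
Proof.
rewrite sqr_dist; transitivity (dot u u * dot (Y - Z) (Y - Z)); first by rewrite uu mul1r.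
by rewrite /x /y /dot /perp /=; field; rewrite an bn.
Qed.

Section triangle.
Variable P : 'I_3 -> point2.
Hypothesis P_family : poncelet3_family E (circle O r) P.

Lemma coord_neq i : (x (P i), y (P i)) <> (x (P (ordS i)), y (P (ordS i))).
Proof.
case=> e1 e2; case: P_family => + _ _; rewrite /is_triangle -(det3_cyclic P i).
rewrite (det3_split O) !(det3_rot O) !det3_coord /opp1 /opp2 e1 e2 => /eqP; apply; ring.
Qed.

Lemma coord_conjugate i :
  ((a * b) ^+ 2 + r ^+ 2 * (a ^+ 2 - b ^+ 2)) * x (P i) * x (P (ordS i)) +
  ((a * b) ^+ 2 - r ^+ 2 * (a ^+ 2 - b ^+ 2)) * y (P i) * y (P (ordS i)) =
  r ^+ 2 * (a ^+ 2 + b ^+ 2) - (a * b) ^+ 2.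
Proof.
have [_ PE Ptan] := P_family.
apply: chord_tangent; [exact: PE|exact: PE|exact: coord_neq|].
have [_] := tangent_circle (Ptan (ordS (ordS i))).
by rewrite /opp1 /opp2 !ordS3 det3_rot det3_coord dist_coord.
Qed.

Lemma vertex_relation i
  (A := (a * b) ^+ 2 + r ^+ 2 * (a ^+ 2 - b ^+ 2))
  (B := (a * b) ^+ 2 - r ^+ 2 * (a ^+ 2 - b ^+ 2))
  (k := r ^+ 2 * (a ^+ 2 + b ^+ 2) - (a * b) ^+ 2) :
  k ^+ 2 * (A + B) =
  A ^+ 2 * (B + k) * x (P i) ^+ 2 + B ^+ 2 * (A + k) * y (P i) ^+ 2.
Proof.
have [_ PE _] := P_family.
have r2 : r ^+ 2 < b ^+ 2 by rewrite ltrXn2r // ?nnegrE ltW.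
have ba2 : b ^+ 2 < a ^+ 2 by rewrite ltrXn2r // ?nnegrE ltW.
have r20 : 0 < r ^+ 2 by rewrite exprn_gt0.
have b20 : 0 < b ^+ 2 by rewrite exprn_gt0.
have a20 : 0 < a ^+ 2 by rewrite exprn_gt0.
have A0 : 0 < A.
  by rewrite addr_gt0 ?exprn_gt0 ?mulr_gt0 // subr_gt0.
have B0 : 0 < B.
  rewrite (_ : B = a ^+ 2 * (b ^+ 2 - r ^+ 2) + r ^+ 2 * b ^+ 2); last by rewrite /B; ring.
  by rewrite addr_gt0 ?mulr_gt0 // subr_gt0.
apply: (conjugate_vertex A0 B0 (PE i) (PE (ordS i)) (PE (ordS (ordS i)))).
- exact: coord_neq.
- exact: coord_conjugate.
- by rewrite /k -(coord_conjugate (ordS (ordS i))) ordS3 /A /B; ring.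
- exact: coord_conjugate.
Qed.
End triangle.

Lemma porism_radiusE : admits_poncelet3_family E (circle O r) -> a * b = r * (a + b).
Proof.
move=> porism.
apply: porism_radius => //.
(* An end of the major axis; the other case takes an end of the minor axis. *)
- pose X : point2 := (O.1 + a * u.1, O.2 + a * u.2).
  have xX : x X = 1.
    have e : dot (X - O) u = a * dot u u by rewrite /X /dot /=; ring.
    by rewrite /x e uu mulr1 mulfV.
  have yX : y X = 0 by rewrite /y (_ : dot _ _ = 0) ?mul0r // /X /dot /=; ring.
  have [|P hP [i iX]] := porism X; first by rewrite /E /= xX yX expr0n expr1n addr0.
  by rewrite (vertex_relation hP i) iX xX yX; ring.
- pose X : point2 := (O.1 - b * u.2, O.2 + b * u.1).
  have xX : x X = 0 by rewrite /x (_ : dot _ _ = 0) ?mul0r // /X /dot /=; ring.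
  have yX : y X = 1.
    have e : dot (X - O) (perp u) = b * dot u u by rewrite /X /dot /=; ring.
    by rewrite /y e uu mulr1 mulfV.
  have [|P hP [i iX]] := porism X; first by rewrite /E /= xX yX expr0n expr1n add0r.
  by rewrite (vertex_relation hP i) iX xX yX; ring.
Qed.

Section family.
Hypothesis rE : a * b = r * (a + b).
Variable P : 'I_3 -> point2.
Hypothesis P_family : poncelet3_family E (circle O r) P.
Let p := b / (a + b).
Let q := a / (a + b).
Let t := p * q.
Let w i := q ^+ 2 * x (P i) ^+ 2 + p ^+ 2 * y (P i) ^+ 2.
(** The barycentric coordinates of [O], in the form that [conjugate_barycentric] provides. *)
Let lam i := t / (w i + 2 * t).
Let ab0 : a + b != 0. Proof. by rewrite gt_eqF // addr_gt0. Qed.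
Let p0 : 0 < p. Proof. by rewrite divr_gt0 // addr_gt0. Qed.
Let q0 : 0 < q. Proof. by rewrite divr_gt0 // addr_gt0. Qed.
Let pq1 : p + q = 1. Proof. by rewrite /p /q; field. Qed.
Let t0 : 0 < t. Proof. by rewrite mulr_gt0. Qed.
Let PE i : x (P i) ^+ 2 + y (P i) ^+ 2 = 1. Proof. by case: P_family => _ /(_ i). Qed.
Let w0 i : 0 < w i. Proof. exact: conjugate_norm_gt0. Qed.
Let wt0 i : 0 < w i + 2 * t. Proof. by rewrite addr_gt0 // mulr_gt0. Qed.

Let conj i : q * x (P i) * x (P (ordS i)) + p * y (P i) * y (P (ordS i)) = - t.
Proof.
have := coord_conjugate P_family i.
have -> : (a * b) ^+ 2 = r ^+ 2 * (a + b) ^+ 2 by rewrite rE exprMn.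
(* After the substitution [a b = r (a + b)], all coefficients are multiples of [2 r^2 (a + b)^2]. *)
move=> h; have r2 : 2 * r ^+ 2 * (a + b) ^+ 2 != 0.
  by rewrite !mulf_neq0 ?expf_neq0 ?pnatr_eq0 // gt_eqF.
apply: (mulfI r2).
transitivity ((r ^+ 2 * (a + b) ^+ 2 + r ^+ 2 * (a ^+ 2 - b ^+ 2)) * x (P i) *
     x (P (ordS i)) +
     (r ^+ 2 * (a + b) ^+ 2 - r ^+ 2 * (a ^+ 2 - b ^+ 2)) * y (P i) *
     y (P (ordS i))); first by rewrite /p /q; field.
by rewrite h /t /p /q; field.
Qed.

Let d i := x (P (ordS i)) * y (P (ordS (ordS i))) - x (P (ordS (ordS i))) * y (P (ordS i)).
Let Dz := d 0 + d 1 + d 2%:R.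
Let D := det3 (P 0) (P 1) (P 2%:R).

Let DzE i : d i + d (ordS i) + d (ordS (ordS i)) = Dz.
Proof.
rewrite -(sum3_cyclic i d) (sum3_cyclic 0).
by rewrite /Dz; congr (d _ + d _ + d _); apply: val_inj.
Qed.

Let DE : D = a * b * Dz.
Proof.
rewrite /D -(det3_cyclic P 0) (det3_split O) !(det3_rot O) !det3_coord -!mulrDr -(DzE 0).
by rewrite /d !ordS3.
Qed.

Let Dz0 : Dz != 0.
Proof.
have [h _ _] := P_family; move: h; rewrite /is_triangle -/D DE !mulf_eq0.
by rewrite (negPf an) (negPf bn).
Qed.

Let Dzi i : d i + (x (P (ordS (ordS i))) * y (P i) - x (P i) * y (P (ordS (ordS i)))) +
    (x (P i) * y (P (ordS i)) - x (P (ordS i)) * y (P i)) = Dz.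
Proof. by rewrite -(DzE i) /d !ordS3. Qed.

Let incenter_bary i : det3 (opp1 P i) (opp2 P i) O = lam i * D.
Proof.
have conj' : q * x (P i) * x (P (ordS (ordS i))) + p * y (P i) * y (P (ordS (ordS i))) = - t.
  by rewrite -(conj (ordS (ordS i))) ordS3; ring.
have := conjugate_barycentric pq1 (PE i) (conj i) conj'; rewrite -/(d i) -/t -/(w i) Dzi.
rewrite det3_rot det3_coord -/(d i) DE => h.
have dE : d i = t * Dz / (w i + 2 * t) by rewrite -h mulfK // gt_eqF.
by rewrite /opp1 /opp2 -/(d i) dE /lam; ring.
Qed.

Let symm : [/\ w 0 * w 1 * w 2%:R = 4 * t ^+ 4,
      w 1 * w 2%:R + w 0 * w 2%:R + w 0 * w 1 = 4 * t ^+ 2 * (1 - t) &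
      t ^+ 2 * Dz ^+ 2 = (w 0 + 2 * t) * (w 1 + 2 * t) * (w 2%:R + 2 * t)].
Proof.
have o0 : ordS (0 : 'I_3) = 1 by apply: val_inj.
have o1 : ordS (1 : 'I_3) = 2%:R by apply: val_inj.
have o2 : ordS (2%:R : 'I_3) = 0 by apply: val_inj.
have := (conj 0, conj 1, conj 2%:R); rewrite !(o0, o1, o2) => -[[c0 c1] c2].
have D012 := Dzi 0; rewrite /d !(o0, o1, o2) in D012.
have := @conjugate_symmetric _ _ _ p0 q0 pq1 _ _ _ _ _ _ (PE 0) (PE 1) (PE 2%:R) c0 c1 c2.
by rewrite D012 => /(_ Dz0).
Qed.

Let lam_lt i : 1 - 2 * lam i = w i / (w i + 2 * t).
Proof. by rewrite /lam; field; rewrite gt_eqF. Qed.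

Let P_triangle : is_triangle P. Proof. by case: P_family. Qed.
Let P_tangent i : tangent (side_line P i) (circle O r).
Proof. by case: P_family => _ _ /(_ i). Qed.
Let lam_gt0 i : 0 < lam i. Proof. by rewrite divr_gt0. Qed.
Let wtn i : w i + 2 * t != 0. Proof. by rewrite gt_eqF. Qed.
Let wn i : w i != 0. Proof. by rewrite gt_eqF. Qed.
Let tn : t != 0. Proof. by rewrite gt_eqF. Qed.

Let prod_lam : lam 0 * lam 1 * lam 2%:R = t / Dz ^+ 2.
Proof.
have [_ _ e] := symm.
rewrite (_ : lam 0 * _ * _ = t ^+ 3 / ((w 0 + 2 * t) * (w 1 + 2 * t) * (w 2%:R + 2 * t))).
  by rewrite -e; field; rewrite Dz0 tn.
by rewrite /lam; field; rewrite !wtn.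
Qed.

Lemma poncelet_inradius : inradius P = r.
Proof. exact: inradiusE P_triangle r_gt0 lam_gt0 P_tangent incenter_bary. Qed.

(** By [prod_lam], the product of the [lam i] varies inversely to the squared area, so the
    dependence on the triangle cancels. *)
Lemma poncelet_circumradius : circumradius P = (a + b) / 2.
Proof.
rewrite (circumradiusE P_triangle r_gt0 lam_gt0 P_tangent incenter_bary).
rewrite prod_lam -/D DE.
have rn : r != 0 by rewrite gt_eqF.
have -> : t / Dz ^+ 2 * (a * b * Dz) ^+ 2 = (a * b) ^+ 3 / (a + b) ^+ 2.
  by rewrite /t /p /q; field; rewrite ab0 Dz0.
by rewrite rE; field; rewrite rn ab0.
Qed.

(** Here [kap = a b], since [E] is the circumellipse centered at [O]. *)
Lemma poncelet_excentral_circumellipse i :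
  exists C, [/\ is_circumellipse P (anticevian P O i) C,
    area C = (pi * (a * b) / (1 - 2 * lam i))%:E &
    forall C', is_circumellipse P (anticevian P O i) C' -> C' = C].
Proof.
apply: (excentral_circumellipse P_triangle r_gt0 lam_gt0 P_tangent incenter_bary).
- by rewrite mulr_gt0.
- by move=> j; rewrite lam_lt divr_gt0.
have o1 : ordS (0 : 'I_3) = 1 by apply: val_inj.
have o2 : ordS (1 : 'I_3) = 2%:R by apply: val_inj.
rewrite !(prod3_cyclic 0) !(o1, o2) prod_lam -/D DE !lam_lt.
have [e3 _ e] := symm.
transitivity ((a * b) ^+ 2 * (w 0 * w 1 * w 2%:R) /
    ((w 0 + 2 * t) * (w 1 + 2 * t) * (w 2%:R + 2 * t))).
  by field; rewrite !wtn.
by rewrite e3 -e; field; rewrite Dz0 tn.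
Qed.

(** Each [1 / (1 - 2 * lam i)] is [1 + 2 t / w i], and the sum of the [1 / w i] is a quotient of the
    two symmetric functions made constant by [symm]. *)
Lemma sum_excentral_area :
  \sum_i pi * (a * b) / (1 - 2 * lam i) = pi * (a * b) * (1 + 2 / t).
Proof.
have o1 : ordS (0 : 'I_3) = 1 by apply: val_inj.
have o2 : ordS (1 : 'I_3) = 2%:R by apply: val_inj.
have [e3 e2 _] := symm.
rewrite (sum3_cyclic 0) !(o1, o2) !lam_lt.
transitivity (pi * (a * b) * (3 + 2 * t *
  (w 1 * w 2%:R + w 0 * w 2%:R + w 0 * w 1) / (w 0 * w 1 * w 2%:R))).
  by field; rewrite !wn !wtn.
by rewrite e2 e3; field.
Qed.
End family.
End porism.

Theorem lemma3 (R : realType) (a b r : R) (O : R * R) (E E' : set (R * R))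
    (r_gt0 : 0 < r) (lt_rb : r < b) (lt_ba : b < a)
    (defE : is_ellipse O a b E) (defE' : E' = circle O r)
    (porism : admits_poncelet3_family E E') :
  area E = (pi * a * b)%:E /\
  exists Sigma : R, forall P, poncelet3_family E E' P ->
    [/\ forall i, exists! C, is_circumellipse P (anticevian P O i) C,
        forall C : 'I_3 -> set (R * R),
          (forall i, is_circumellipse P (anticevian P O i) (C i)) ->
          (\sum_(i < 3) area (C i))%E = Sigma%:E &
        Sigma%:E = ((1 + 4 / (inradius P / circumradius P))%:E * area E)%E].
Proof.
have b0 : 0 < b := lt_trans r_gt0 lt_rb.
have a0 : 0 < a := lt_trans b0 lt_ba.
have areaE : area E = (pi * a * b)%:E.
  have [A [B [C [C0 dE ->]]]] := ellipse_conic defE.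
  rewrite area_conic // dE ?invr_gt0 ?exprn_gt0 ?mulr_gt0 //; congr EFin.
  by rewrite sqrtrV ?sqr_ge0 // sqrtr_sqr gtr0_norm ?mulr_gt0 // invrK mulrA.
split=> //; case: defE => _ _ [u uu EE].
rewrite defE' EE in porism *; have rE := porism_radiusE uu r_gt0 lt_rb lt_ba porism.
exists (pi * (a * b) * (1 + 2 / (b / (a + b) * (a / (a + b))))) => P hP.
have circ := poncelet_excentral_circumellipse uu r_gt0 lt_rb lt_ba rE hP.
split.
- by move=> i; have [C [C1 _ C2]] := circ i; exists C; split=> // C' /C2.
- move=> C hC.
  rewrite -(sum_excentral_area uu r_gt0 lt_rb lt_ba rE hP) -sumEFin.
  (* Uniqueness identifies the given circumellipse with the one of known area. *)
  by apply: eq_bigr => i _; have [C0 [_ <- /(_ _ (hC i)) ->]] := circ i.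
rewrite -EE areaE (poncelet_inradius uu r_gt0 lt_rb lt_ba rE hP).
rewrite (poncelet_circumradius uu r_gt0 lt_rb lt_ba rE hP) -EFinM; congr EFin.
have abn : a + b != 0 by rewrite gt_eqF // addr_gt0.
(* With this value the ratio of the radii is [2 a b / (a + b)^2], twice the [t] of the family. *)
have -> : r = a * b / (a + b) by rewrite rE mulfK.
by field; rewrite abn !gt_eqF.
Qed.
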